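(* Let $G=\langle x_1,\dots,x_n\mid r\rangle$ be a $1$-relator group, and let $\mathfrak{h}=\mathfrak{h}(G)$ be its holonomy Lie algebra, with universal enveloping algebra $U(\mathfrak{h})$. Then \[ \operatorname{Hilb}(U(\mathfrak{h});t)=\begin{cases}1/(1-(n-1)t)&\text{if }\omega(r)=1,\\ 1/(1-nt+t^2)&\text{if }\omega(r)=2,\\ 1/(1-nt)&\text{if }\omega(r)\ge 3.\end{cases} \]
   Context: Let $F$ be the free group on $x_1,\dots,x_n$, with lower central series $\Gamma_1F=F$, $\Gamma_{k+1}F=[\Gamma_kF,F]$. The weight of $r\in F$ is $\omega(r)=\sup\{k\mid r\in\Gamma_kF\}$. For a finitely generated group $G$, the holonomy Lie algebra is the graded Lie algebra $\mathfrak{h}(G)=\mathfrak{lie}(H_1(G;\mathbb{Q}))/\langle\operatorname{im}\mu_G^\vee\rangle$, where $\mathfrak{lie}(V)$ is the free $\mathbb{Q}$-Lie algebra on $V$ (in degree $1$) and $\mu_G^\vee\colon H_2(G;\mathbb{Q})\to\bigwedge^2H_1(G;\mathbb{Q})\cong\mathfrak{lie}_2(H_1(G;\mathbb{Q}))$ (with $v\wedge w\leftrightarrow[v,w]$) is the dual of the cup-product map $\mu_G\colon H^1(G;\mathbb{Q})\wedge H^1(G;\mathbb{Q})\to H^2(G;\mathbb{Q})$. For a graded vector space $V=\bigoplus_kV_k$, $\operatorname{Hilb}(V;t)=\sum_k\dim_{\mathbb{Q}}(V_k)t^k$; $U(\mathfrak{h})$ carries the grading induced from $\mathfrak{h}$.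 *)

(* Defs.v *)
From HB Require Import structures.
From mathcomp Require Import all_boot all_algebra.
From mathcomp Require Import boolp classical_sets functions.
From mathcomp Require Import finmap monalg ring.

Set Implicit Arguments.
Unset Strict Implicit.
Unset Printing Implicit Defensive.

Import GRing.Theory.
Local Open Scope quotient_scope.
Local Open Scope ring_scope.

Section PropEquiv.
Variables (T : choiceType) (E : T -> T -> Prop).
Hypotheses (Er : forall x, E x x) (Es : forall x y, E x y -> E y x).
Hypothesis (Et : forall x y z, E x y -> E y z -> E x z).

Let e : rel T := fun x y => `[< E x y >].
Fact prop_equiv_refl : reflexive e. Proof. by move=> x; apply/asboolP. Qed.
Fact prop_equiv_sym : symmetric e.
Proof. by move=> x y; apply/idP/idP => /asboolP h; apply/asboolP/Es. Qed.
Fact prop_equiv_trans : transitive e.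
Proof. by move=> y x z /asboolP a /asboolP b; apply/asboolP/(Et a b). Qed.

Definition prop_equiv : equiv_rel T :=
  EquivRel e prop_equiv_refl prop_equiv_sym prop_equiv_trans.

Lemma prop_quotP (x y : T) : x = y %[mod {eq_quot prop_equiv}] <-> E x y.
Proof.
split=> [/eqmodP/asboolP //|h]; apply/eqmodP; exact/asboolP.
Qed.
End PropEquiv.

Section GroupClosures.
Local Open Scope group_scope.
Variable F : groupType.
Implicit Types (S : set F) (x y : F).

Inductive subgroup_gen S : F -> Prop :=
| sg_1 : subgroup_gen S 1
| sg_in x of S x : subgroup_gen S x
| sg_M x y of subgroup_gen S x & subgroup_gen S y : subgroup_gen S (x * y)
| sg_V x of subgroup_gen S x : subgroup_gen S x^-1.

Inductive normal_closure S : F -> Prop :=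
| nc_1 : normal_closure S 1
| nc_in x of S x : normal_closure S x
| nc_M x y of normal_closure S x & normal_closure S y :
    normal_closure S (x * y)
| nc_V x of normal_closure S x : normal_closure S x^-1
| nc_J x y of normal_closure S x : normal_closure S (x ^ y).

(* [lower_central k] is Gamma_k F for k >= 1; the index 0 is a dummy. *)
Fixpoint lower_central (k : nat) : set F :=
  match k with
  | 0 | 1 => setT
  | k'.+1 => subgroup_gen
      (fun z => exists x y, lower_central k' x /\ z = [~ x, y])
  end.

Definition is_max_depth (r : F) (k : nat) : Prop :=
  [/\ (0 < k)%N, lower_central k r &
      forall j, (0 < j)%N -> lower_central j r -> (j <= k)%N].

(* The weight sup {k >= 1 | r \in Gamma_k F}; [None] stands for +oo.  The set
   contains 1, so its supremum is finite iff it has a maximum. *)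
Definition weight (r : F) : option nat :=
  match pselect (exists k, is_max_depth r k) with
  | left h => Some (sval (cid h))
  | right _ => None
  end.

Definition weight_ge (m : nat) (r : F) : Prop :=
  if weight r is Some k then (m <= k)%N else True.

Lemma weight_SomeP r k : weight r = Some k <-> is_max_depth r k.
Proof.
rewrite /weight; case: pselect => [h|nh]; last first.
  by split=> // h; case: nh; exists k.
case: (cid h) => j /= hj; split=> [[<-] //|hk]; congr Some.
case: hj => j0 hj1 hj2; case: hk => k0 hk1 hk2.
by apply/eqP; rewrite eqn_leq hk2 // hj2.
Qed.

End GroupClosures.

Section QuotientGroup.
Local Open Scope group_scope.
Variables (F : groupType) (S : set F).
Local Notation N := (normal_closure S).

Let E (x y : F) := N (x^-1 * y).
Let Er x : E x x. Proof. rewrite /E mulVg; exact: nc_1. Qed.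
Let Es x y : E x y -> E y x.
Proof. by move=> /nc_V; rewrite /E invgM invgK. Qed.
Let Et x y z : E x y -> E y z -> E x z.
Proof. by move=> a b; have := nc_M a b; rewrite /E mulgA mulgK. Qed.

Definition quotient_group := {eq_quot prop_equiv Er Es Et}.
HB.instance Definition _ := Choice.on quotient_group.
HB.instance Definition _ := EqQuotient.on quotient_group.

Lemma quotient_groupP x y : x = y %[mod quotient_group] <-> N (x^-1 * y).
Proof. exact: prop_quotP. Qed.

Let repr_N x : N ((repr (\pi_quotient_group x))^-1 * x).
Proof. by apply/quotient_groupP; rewrite reprK. Qed.

Definition qg_one : quotient_group := \pi_quotient_group 1.
Definition qg_inv (x : quotient_group) : quotient_group :=
  \pi_quotient_group (repr x)^-1.
Definition qg_mul (x y : quotient_group) : quotient_group :=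
  \pi_quotient_group (repr x * repr y).

Let mulE x y : qg_mul (\pi_quotient_group x) (\pi_quotient_group y) =
  \pi_quotient_group (x * y).
Proof.
apply/quotient_groupP.
set x' := repr _; set y' := repr _.
have -> : (x' * y')^-1 * (x * y) = (x'^-1 * x) ^ y' * (y'^-1 * y).
  by rewrite /conjg invgM !mulgA mulgK.
by apply: nc_M (nc_J _ _) _; apply: repr_N.
Qed.

Let invE x : qg_inv (\pi_quotient_group x) = \pi_quotient_group x^-1.
Proof.
apply/quotient_groupP; set x' := repr _.
have -> : x'^-1^-1 * x^-1 = ((x'^-1 * x) ^ x^-1)^-1.
  by rewrite /conjg mulgK !invgK invgM invgK.
apply: nc_V; apply: nc_J; exact: repr_N.
Qed.

Let mulA : associative qg_mul.
Proof.
elim/quotW=> x; elim/quotW=> y; elim/quotW=> z.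
by rewrite (mulE x y) (mulE y z) !mulE mulgA.
Qed.
Let mul1 : left_id qg_one qg_mul.
Proof. by elim/quotW=> x; rewrite mulE mul1g. Qed.
Let mulr1 : right_id qg_one qg_mul.
Proof. by elim/quotW=> x; rewrite mulE mulg1. Qed.
Let mulV : left_inverse qg_one qg_inv qg_mul.
Proof. by elim/quotW=> x; rewrite invE mulE mulVg. Qed.
Let mulrV : right_inverse qg_one qg_inv qg_mul.
Proof. by elim/quotW=> x; rewrite invE mulE mulgV. Qed.

HB.instance Definition _ :=
  isGroup.Build quotient_group mulA mul1 mulr1 mulV mulrV.

Lemma quotient_group_piM x y :
  \pi_quotient_group (x * y) = \pi_quotient_group x * \pi_quotient_group y.
Proof. by rewrite -[LHS]mulE. Qed.

End QuotientGroup.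

Section FreeGroup.
Variable n : nat.

(* The letter (i, false) is x_i and the letter (i, true) is x_i^-1. *)
Definition letter := ('I_n * bool)%type.
Definition letter_inv (a : letter) : letter := (a.1, ~~ a.2).
Definition word := seq letter.

Inductive word_eq : word -> word -> Prop :=
| we_refl u : word_eq u u
| we_sym u v of word_eq u v : word_eq v u
| we_trans u v w of word_eq u v & word_eq v w : word_eq u w
| we_cancel u a v : word_eq (u ++ a :: letter_inv a :: v) (u ++ v).

Definition free_group := {eq_quot prop_equiv we_refl we_sym we_trans}.
HB.instance Definition _ := Choice.on free_group.
HB.instance Definition _ := EqQuotient.on free_group.

Lemma free_groupP u v : u = v %[mod free_group] <-> word_eq u v.
Proof. exact: prop_quotP. Qed.

Definition word_inv (u : word) : word := rev (map letter_inv u).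

Let letter_invK : involutive letter_inv.
Proof. by case=> i b; rewrite /letter_inv negbK. Qed.

Let we_catl w u v : word_eq u v -> word_eq (w ++ u) (w ++ v).
Proof.
elim=> {u v} [u|u v _ h|u v t _ h _ k|u a v].
- exact: we_refl.
- exact: we_sym.
- exact: we_trans h k.
- rewrite !catA; exact: we_cancel.
Qed.

Let we_catr w u v : word_eq u v -> word_eq (u ++ w) (v ++ w).
Proof.
elim=> {u v} [u|u v _ h|u v t _ h _ k|u a v].
- exact: we_refl.
- exact: we_sym.
- exact: we_trans h k.
- rewrite -!catA; exact: we_cancel.
Qed.

Let we_inv u v : word_eq u v -> word_eq (word_inv u) (word_inv v).
Proof.
elim=> {u v} [u|u v _ h|u v t _ h _ k|u a v].
- exact: we_refl.
- exact: we_sym.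
- exact: we_trans h k.
- rewrite /word_inv !map_cat !rev_cat /= !rev_cons -!cats1
     -!catA letter_invK /=.
  exact: we_cancel.
Qed.

Let we_mulV u : word_eq (u ++ word_inv u) [::].
Proof.
elim/last_ind: u => [|u a ih]; first exact: we_refl.
rewrite /word_inv map_rcons rev_rcons cat_rcons.
exact: we_trans (we_cancel _ _ _) ih.
Qed.

Let we_Vmul u : word_eq (word_inv u ++ u) [::].
Proof.
have := we_mulV (word_inv u).
by rewrite {2}/word_inv map_rev revK mapK.
Qed.

Let repr_we u : word_eq (repr (\pi_free_group u)) u.
Proof. by apply/free_groupP; rewrite reprK. Qed.

Definition fg_one : free_group := \pi_free_group [::].
Definition fg_inv (x : free_group) : free_group :=
  \pi_free_group (word_inv (repr x)).
Definition fg_mul (x y : free_group) : free_group :=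
  \pi_free_group (repr x ++ repr y).

Let mulE u v : fg_mul (\pi_free_group u) (\pi_free_group v) =
  \pi_free_group (u ++ v).
Proof.
apply/free_groupP; apply: (we_trans (we_catr _ (repr_we u))).
exact: we_catl (repr_we v).
Qed.
Let invE u : fg_inv (\pi_free_group u) = \pi_free_group (word_inv u).
Proof. exact/free_groupP/we_inv/repr_we. Qed.

Let mulA : associative fg_mul.
Proof.
elim/quotW=> x; elim/quotW=> y; elim/quotW=> z.
by rewrite (mulE x y) (mulE y z) !mulE catA.
Qed.
Let mul1 : left_id fg_one fg_mul.
Proof. by elim/quotW=> x; rewrite mulE. Qed.
Let mulr1 : right_id fg_one fg_mul.
Proof. by elim/quotW=> x; rewrite mulE cats0. Qed.
Let mulV : left_inverse fg_one fg_inv fg_mul.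
Proof. by elim/quotW=> x; rewrite invE mulE; exact/free_groupP. Qed.
Let mulrV : right_inverse fg_one fg_inv fg_mul.
Proof. by elim/quotW=> x; rewrite invE mulE; exact/free_groupP. Qed.

HB.instance Definition _ :=
  isGroup.Build free_group mulA mul1 mulr1 mulV mulrV.

Definition free_gen (i : 'I_n) : free_group := \pi_free_group [:: (i, false)].

Lemma free_group_piM u v :
  \pi_free_group (u ++ v) = (\pi_free_group u * \pi_free_group v)%g.
Proof. by rewrite -[LHS]mulE. Qed.

Lemma free_group_piV i : \pi_free_group [:: (i, true)] = ((free_gen i)^-1)%g.
Proof. by rewrite -[RHS]/(fg_inv _) invE. Qed.

End FreeGroup.

Definition one_relator_group (n : nat) (r : free_group n) : groupType :=
  quotient_group (fun x => x = r).

Section LinearSpan.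
Variable V : lmodType rat.

Inductive lspan (S : set V) : V -> Prop :=
| lspan_0 : lspan S 0
| lspan_lin a x y of S x & lspan S y : lspan S (a *: x + y).

Lemma lspan_in S x : S x -> lspan S x.
Proof.
by move=> Sx; have := lspan_lin 1 Sx (lspan_0 S); rewrite scale1r addr0.
Qed.

Lemma lspanD S x y : lspan S x -> lspan S y -> lspan S (x + y).
Proof.
move=> hx hy; elim: hx => [|a u v Su _ ih]; first by rewrite add0r.
by rewrite -addrA; apply: lspan_lin.
Qed.

Lemma lspanZ S a x : lspan S x -> lspan S (a *: x).
Proof.
elim=> [|b u v Su _ ih]; first by rewrite scaler0; exact: lspan_0.
by rewrite scalerDr scalerA; apply: lspan_lin.
Qed.

Lemma lspanN S x : lspan S x -> lspan S (- x).
Proof. by rewrite -scaleN1r; exact: lspanZ. Qed.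

End LinearSpan.

Section QuotientModule.
Variables (V : lmodType rat) (S : set V).

Let E (x y : V) := lspan S (x - y).
Let Er x : E x x. Proof. rewrite /E subrr; exact: lspan_0. Qed.
Let Es x y : E x y -> E y x.
Proof. by move=> /lspanN; rewrite /E opprB. Qed.
Let Et x y z : E x y -> E y z -> E x z.
Proof. by move=> a b; have := lspanD a b; rewrite /E addrA subrK. Qed.

Definition quotmod := {eq_quot prop_equiv Er Es Et}.
HB.instance Definition _ := Choice.on quotmod.
HB.instance Definition _ := EqQuotient.on quotmod.

Lemma quotmodP x y : x = y %[mod quotmod] <-> lspan S (x - y).
Proof. exact: prop_quotP. Qed.

Lemma quotmod_repr x : lspan S (repr (\pi_quotmod x) - x).
Proof. by apply/quotmodP; rewrite reprK. Qed.

Definition qm_zero : quotmod := \pi_quotmod 0.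
Definition qm_opp (x : quotmod) : quotmod := \pi_quotmod (- repr x).
Definition qm_add (x y : quotmod) : quotmod := \pi_quotmod (repr x + repr y).
Definition qm_scale (a : rat) (x : quotmod) : quotmod :=
  \pi_quotmod (a *: repr x).

Let oppE x : qm_opp (\pi_quotmod x) = \pi_quotmod (- x).
Proof. by apply/quotmodP; rewrite -opprD; exact/lspanN/quotmod_repr. Qed.
Let addE x y : qm_add (\pi_quotmod x) (\pi_quotmod y) = \pi_quotmod (x + y).
Proof.
apply/quotmodP; rewrite opprD addrACA; apply: lspanD; exact: quotmod_repr.
Qed.
Let scaleE a x : qm_scale a (\pi_quotmod x) = \pi_quotmod (a *: x).
Proof. by apply/quotmodP; rewrite -scalerBr; exact/lspanZ/quotmod_repr. Qed.

Let addA : associative qm_add.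
Proof.
elim/quotW=> x; elim/quotW=> y; elim/quotW=> z.
by rewrite (addE x y) (addE y z) !addE addrA.
Qed.
Let addC : commutative qm_add.
Proof. by elim/quotW=> x; elim/quotW=> y; rewrite !addE addrC. Qed.
Let add0 : left_id qm_zero qm_add.
Proof. by elim/quotW=> x; rewrite addE add0r. Qed.
Let addN : left_inverse qm_zero qm_opp qm_add.
Proof. by elim/quotW=> x; rewrite oppE addE addNr. Qed.

HB.instance Definition _ := GRing.isZmodule.Build quotmod addA addC add0 addN.

Let scaleA a b x : qm_scale a (qm_scale b x) = qm_scale (a * b) x.
Proof. by elim/quotW: x => x; rewrite (scaleE b x) !scaleE scalerA. Qed.
Let scale1 : left_id 1 qm_scale.
Proof. by elim/quotW=> x; rewrite scaleE scale1r. Qed.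
Let scaleDr : right_distributive qm_scale +%R.
Proof.
move=> a; elim/quotW=> x; elim/quotW=> y.
rewrite -[X in qm_scale a X]/(qm_add _ _) -[RHS]/(qm_add _ _).
by rewrite (addE x y) (scaleE a x) (scaleE a y) addE scaleE scalerDr.
Qed.
Let scaleDl x : {morph qm_scale^~ x : a b / a + b}.
Proof.
elim/quotW: x => x a b; rewrite /= -[RHS]/(qm_add _ _).
by rewrite (scaleE a x) (scaleE b x) addE scaleE scalerDl.
Qed.

HB.instance Definition _ :=
  GRing.Zmodule_isLmodule.Build rat quotmod scaleA scale1 scaleDr scaleDl.

Lemma quotmod_pi_linear : linear (\pi_quotmod : V -> quotmod).
Proof.
move=> a x y; rewrite -[RHS]/(qm_add (qm_scale _ _) _).
by rewrite (scaleE a x) addE.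
 Qed.

HB.instance Definition _ :=
  GRing.isLinear.Build rat V quotmod _ (\pi_quotmod) quotmod_pi_linear.

End QuotientModule.

Section LinearExtension.
Variables (K : choiceType) (V : lmodType rat) (f : K -> V).

Definition lin_ext (c : {malg rat[K]}) : V :=
  \sum_(k <- msupp c) c@_k *: f k.

Lemma lin_extEw (d : {fset K}) c :
  (msupp c `<=` d)%fset -> lin_ext c = \sum_(k <- d) c@_k *: f k.
Proof.
move=> h; apply: big_fset_incl => // k _ /mcoeff_outdom ->.
by rewrite scale0r.
Qed.

Fact lin_ext_linear : linear lin_ext.
Proof.
move=> a x y.
pose d := (msupp x `|` msupp y `|` msupp (a *: x + y))%fset.
rewrite (@lin_extEw d (a *: x + y)) ?fsubsetUr //.
rewrite (@lin_extEw d x); last by rewrite /d -fsetUA fsubsetUl.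
rewrite (@lin_extEw d y); last by rewrite /d fsetUAC fsubsetUr.
rewrite scaler_sumr -big_split /=; apply: eq_bigr => k _.
by rewrite mcoeffD mcoeffZ scalerDl scalerA.
Qed.

HB.instance Definition _ :=
  GRing.isLinear.Build rat {malg rat[K]} V _ lin_ext lin_ext_linear.

Lemma lin_extU k : lin_ext << k >> = f k.
Proof.
by rewrite (@lin_extEw [fset k]%fset) ?msuppU_le // big_seq_fset1
  mcoeffUU scale1r.
Qed.

End LinearExtension.

Lemma linear_lin_ext (K : choiceType) (V W : lmodType rat)
    (g : {linear V -> W}) (f : K -> V) c :
  g (lin_ext f c) = lin_ext (fun k => g (f k)) c.
Proof. by rewrite linear_sum; apply: eq_bigr => k _; rewrite linearZ. Qed.

Section ExteriorSquare.
Variable V : lmodType rat.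

Inductive ext2_rel : {malg rat[(V * V)%type]} -> Prop :=
| ext2_linl a u v w : ext2_rel
    (<< (a *: u + v, w) >> - (a *: << (u, w) >> + << (v, w) >>))
| ext2_linr a u v w : ext2_rel
    (<< (w, a *: u + v) >> - (a *: << (w, u) >> + << (w, v) >>))
| ext2_alt v : ext2_rel << (v, v) >>.

Definition ext2 : lmodType rat := quotmod ext2_rel.

Definition wedge (v w : V) : ext2 := \pi_ext2 << (v, w) >>.

(* The linear map v /\ w |-> f v w, for f bilinear and alternating (see
   [ext2_lift_wedge]); meaningless for other f. *)
Definition ext2_lift (W : lmodType rat) (f : V -> V -> W) (w : ext2) : W :=
  lin_ext (fun p => f p.1 p.2) (repr w).

Section Lift.
Variables (W : lmodType rat) (f : V -> V -> W).
Hypothesis fl : forall a u v w, f (a *: u + v) w = a *: f u w + f v w.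
Hypothesis fr : forall a u v w, f w (a *: u + v) = a *: f w u + f w v.
Hypothesis fa : forall v, f v v = 0.

Lemma ext2_lift_pi c :
  ext2_lift f (\pi_ext2 c) = lin_ext (fun p => f p.1 p.2) c.
Proof.
apply/eqP; rewrite -subr_eq0 /ext2_lift -linearB; apply/eqP.
elim: (quotmod_repr ext2_rel c) => [|a x y hx _ ih]; first exact: linear0.
rewrite linearP ih addr0.
case: hx => [b u v w|b u v w|v].
- by rewrite linearB /= linearP /= !lin_extU /= fl subrr scaler0.
- by rewrite linearB /= linearP /= !lin_extU /= fr subrr scaler0.
- by rewrite /= lin_extU /= fa scaler0.
Qed.

Lemma ext2_lift_wedge v w : ext2_lift f (wedge v w) = f v w.
Proof. by rewrite ext2_lift_pi lin_extU. Qed.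

Lemma ext2_lift_linear : linear (ext2_lift f).
Proof.
move=> a; elim/quotW=> x; elim/quotW=> y.
by rewrite -linearP !ext2_lift_pi linearP.
Qed.
End Lift.

End ExteriorSquare.

(* Chains and cochains of the inhomogeneous bar complex of G, with trivial
   coefficients Q. *)
Section BarComplex.
Variable G : groupType.

Definition bar_d2 : {malg rat[(G * G)%type]} -> {malg rat[G]} :=
  lin_ext (fun g => << g.2 >> - << (g.1 * g.2)%g >> + << g.1 >>).

Definition bar_d3 : {malg rat[(G * G * G)%type]} -> {malg rat[(G * G)%type]} :=
  lin_ext (fun g => let: (a, b, c) := g in
    << (b, c) >> - << ((a * b)%g, c) >> + << (a, (b * c)%g) >> - << (a, b) >>).

HB.instance Definition _ := GRing.Linear.on bar_d2.
HB.instance Definition _ := GRing.Linear.on bar_d3.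

Definition cochain1 : lmodType rat := (G -> rat^o).
Definition cochain2 : lmodType rat := (G -> G -> rat^o).

Definition cobar_d1 (f : cochain1) : cochain2 :=
  fun a b => f b - f (a * b)%g + f a.

Definition cobar_d2 (f : cochain2) : G -> G -> G -> rat :=
  fun a b c => f b c - f (a * b)%g c + f a ((b * c)%g) - f a b.

Definition is_cycle2 : {pred {malg rat[(G * G)%type]}} :=
  fun z => bar_d2 z == 0.
Definition is_cocycle1 : {pred cochain1} := fun f => cobar_d1 f == 0.
Definition is_cocycle2 : {pred cochain2} := fun f => cobar_d2 f == 0.

Fact is_cycle2_submod : submod_closed is_cycle2.
Proof.
split=> [|a x y]; rewrite !unfold_in ?linear0 //.
by move=> /eqP hx /eqP hy; rewrite linearP /= hx hy scaler0 addr0.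
Qed.
HB.instance Definition _ :=
  GRing.isSubmodClosed.Build rat _ is_cycle2 is_cycle2_submod.

Lemma is_cocycle1P f : reflect (forall a b, f (a * b)%g = f a + f b)
                               (is_cocycle1 f).
Proof.
apply: (iffP eqP) => [h a b|h].
  have /eqP : cobar_d1 f a b = 0 by rewrite h.
  by rewrite /cobar_d1 addrAC subr_eq0 addrC => /eqP.
apply/funext=> a; apply/funext=> b.
rewrite /cobar_d1 h -[RHS]/(0 : rat); ring.
Qed.

Fact is_cocycle1_submod : submod_closed is_cocycle1.
Proof.
split=> [|a f g]; first by apply/is_cocycle1P => x y; rewrite addr0.
move=> /is_cocycle1P hf /is_cocycle1P hg; apply/is_cocycle1P => x y.
by rewrite !addrfctE !scalrfctE hf hg scalerDr addrACA.
Qed.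
HB.instance Definition _ :=
  GRing.isSubmodClosed.Build rat _ is_cocycle1 is_cocycle1_submod.

Lemma is_cocycle2P f : reflect (forall a b c, cobar_d2 f a b c = 0)
                               (is_cocycle2 f).
Proof.
apply: (iffP eqP) => [-> //|h].
by apply/funext=> a; apply/funext=> b; apply/funext=> c; rewrite h.
Qed.

Fact is_cocycle2_submod : submod_closed is_cocycle2.
Proof.
split=> [|k f g].
  by apply/is_cocycle2P => a b c; rewrite -[LHS]/(0 - 0 + 0 - 0 : rat); ring.
move=> /is_cocycle2P hf /is_cocycle2P hg; apply/is_cocycle2P => a b c.
transitivity (k * cobar_d2 f a b c + cobar_d2 g a b c).
  rewrite /cobar_d2 !addrfctE !scalrfctE /GRing.scale /=; ring.
by rewrite hf hg mulr0 addr0.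
Qed.
HB.instance Definition _ :=
  GRing.isSubmodClosed.Build rat _ is_cocycle2 is_cocycle2_submod.

Definition cycle2 := {z | is_cycle2 z}.
HB.instance Definition _ := SubType.on cycle2.
HB.instance Definition _ := Choice.on cycle2.
HB.instance Definition _ := [SubChoice_isSubLmodule of cycle2 by <:].

Definition cocycle1 := {f | is_cocycle1 f}.
HB.instance Definition _ := SubType.on cocycle1.
HB.instance Definition _ := Choice.on cocycle1.
HB.instance Definition _ := [SubChoice_isSubLmodule of cocycle1 by <:].

Definition cocycle2 := {f | is_cocycle2 f}.
HB.instance Definition _ := SubType.on cocycle2.
HB.instance Definition _ := Choice.on cocycle2.
HB.instance Definition _ := [SubChoice_isSubLmodule of cocycle2 by <:].

(* The differentials C_1 -> C_0 and C^0 -> C^1 vanish, since the action on Q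
   is trivial: every 1-chain is a cycle and H^1 = Z^1. *)
Definition homology1 : lmodType rat :=
  quotmod (fun z : {malg rat[G]} => exists c, z = bar_d2 c).
Definition homology2 : lmodType rat :=
  quotmod (fun z : cycle2 => exists c, val z = bar_d3 c).
Definition cohomology1 : lmodType rat := cocycle1.
Definition cohomology2 : lmodType rat :=
  quotmod (fun f : cocycle2 => exists g, val f = cobar_d1 g).

Fact cup_is_cocycle (f g : cocycle1) :
  is_cocycle2 (fun a b => val f a * val g b).
Proof.
case: f g => [f /is_cocycle1P hf] [g /is_cocycle1P hg] /=.
by apply/is_cocycle2P => a b c; rewrite /cobar_d2 hf hg; ring.
Qed.

Definition cup_cochain (f g : cocycle1) : cocycle2 :=
  exist is_cocycle2 _ (cup_is_cocycle f g).

Definition cup (f g : cohomology1) : cohomology2 :=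
  \pi_cohomology2 (cup_cochain f g).

Definition cup_product_map : ext2 cohomology1 -> cohomology2 :=
  ext2_lift cup.

Definition eval1 (f : cohomology1) (z : homology1) : rat :=
  lin_ext (val f : G -> rat^o) (repr z).
Definition eval2 (f : cohomology2) (z : homology2) : rat :=
  lin_ext (fun g => val (repr f) g.1 g.2 : rat^o) (val (repr z)).

(* The pairing of H^1 /\ H^1 with H_1 /\ H_1:
   <f /\ g, v /\ w> = f(v) g(w) - f(w) g(v). *)
Definition ext2_eval (w : ext2 cohomology1) (x : ext2 homology1) : rat :=
  ext2_lift (fun f g : cohomology1 =>
    ext2_lift (fun v w : homology1 =>
      (eval1 f v * eval1 g w - eval1 f w * eval1 g v : rat^o)) x) w.

(* The image of the dual mu_G^v : H_2 -> H_1 /\ H_1 of mu_G: the value x of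
   mu_G^v at z is characterised by the adjunction
   <w, mu_G^v z> = <mu_G w, z> for all w in H^1 /\ H^1
   (uniquely if H_1 is finite-dimensional, e.g. for G finitely generated). *)
Definition im_dual_cup : set (ext2 homology1) :=
  fun x => exists z : homology2,
    forall w : ext2 cohomology1, ext2_eval w x = eval2 (cup_product_map w) z.

Lemma eval1_pi f z :
  eval1 f (\pi_homology1 z) = lin_ext (val f : G -> rat^o) z.
Proof.
apply/eqP; rewrite -subr_eq0 -[_ - _]/(_ - _ : rat^o) -linearB; apply/eqP.
elim: (quotmod_repr (fun z : {malg rat[G]} => exists c, z = bar_d2 c) z).
  exact: linear0.
move=> a _ y [c ->] _ ih; rewrite linearP /= ih addr0.
have /is_cocycle1P hf := valP f.
suff -> : lin_ext (val f : G -> rat^o) (bar_d2 c) = 0 by rewrite scaler0.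
rewrite /bar_d2 linear_lin_ext [LHS]big1 // => k _.
rewrite /= linearD linearB /=.
have e (s t : rat^o) : t - (s + t) + s = 0.
  by rewrite opprD addrCA subrr addr0 addNr.
by rewrite !lin_extU hf e scaler0.
Qed.

Lemma eval2_pi f z :
  eval2 (\pi_cohomology2 f) (\pi_homology2 z) =
  lin_ext (fun g => val f g.1 g.2 : rat^o) (val z).
Proof.
pose Sf := fun f : cocycle2 => exists g, val f = cobar_d1 g.
pose Sz := fun z : cycle2 => exists c, val z = bar_d3 c.
pose ev (f : cochain2) : {malg rat[(G * G)%type]} -> rat^o :=
  lin_ext (fun g => f g.1 g.2 : rat^o).
have ev_cob h y : ev (cobar_d1 h) y = lin_ext (h : G -> rat^o) (bar_d2 y).
  rewrite /bar_d2 linear_lin_ext; apply: eq_bigr => k _; congr (_ *: _).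
  by rewrite /= linearD linearB /= !lin_extU.
have evl (f' : cochain2) a x y : ev f' (a *: x + y) = a *: ev f' x + ev f' y.
  exact: linearP.
have ev_b3 (f' : cocycle2) c : ev (val f') (bar_d3 c) = 0.
  have /is_cocycle2P hf := valP f'.
  rewrite /bar_d3 /ev linear_lin_ext [LHS]big1 // => -[[a b] d] _.
  rewrite [X in _ *: X](_ : _ = 0) ?scaler0 //.
  by rewrite linearB linearD linearB /= !lin_extU; exact: hf.
have stepz f' (z' : cycle2) : lspan Sz z' ->
    ev (val (f' : cocycle2)) (val z') = 0.
  elim=> [|a x y [c xc] _ ih]; first exact: linear0.
  by rewrite linearP /= evl ih addr0 xc ev_b3 scaler0.
have stepf f' (z' : cycle2) : lspan Sf f' ->
    ev (val (f' : cocycle2)) (val z') = 0.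
  elim=> [|a x y [g xg] _ ih].
    by rewrite /ev /lin_ext big1 // => k _; exact: scaler0.
  have -> : ev (val (a *: x + y)) (val z') =
    a *: ev (val x) (val z') + ev (val y) (val z').
    rewrite /ev /lin_ext scaler_sumr -big_split /=; apply: eq_bigr => k _.
    by rewrite -[LHS]/(_ * (a * _ + _)) mulrDr mulrCA.
  by rewrite ih addr0 xg ev_cob (eqP (valP z')) linear0 scaler0.
have evB (f1 f2 : cocycle2) y :
    ev (val (f1 - f2)) y = ev (val f1) y - ev (val f2) y.
  rewrite /ev /lin_ext -sumrB; apply: eq_bigr => k _.
  by rewrite -[LHS]/(_ * (_ - _)) mulrBr.
have evBz (f' : cocycle2) (z1 z2 : cycle2) :
    ev (val f') (val (z1 - z2)) = ev (val f') (val z1) - ev (val f') (val z2).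
  by rewrite /ev !linearB.
rewrite /eval2 -/(ev (val f) (val z)) -/(ev (val (repr _)) (val (repr _))).
apply/eqP; rewrite -subr_eq0; apply/eqP.
rewrite -(subrKA (ev (val f) (val (repr (\pi_homology2 z))))).
rewrite -evB stepf ?add0r; last exact: quotmod_repr.
by rewrite -evBz stepz //; exact: quotmod_repr.
Qed.

Lemma cup_linl a f g h : cup (a *: f + g) h = a *: cup f h + cup g h.
Proof.
rewrite /cup -linearP; congr (\pi_cohomology2 _); apply: val_inj.
apply/funext=> x; apply/funext=> y /=.
by rewrite -[LHS]/((a * _ + _) * _) mulrDl -mulrA.
Qed.

Lemma cup_linr a f g h : cup h (a *: f + g) = a *: cup h f + cup h g.
Proof.
rewrite /cup -linearP; congr (\pi_cohomology2 _); apply: val_inj.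
apply/funext=> x; apply/funext=> y /=.
by rewrite -[LHS]/(_ * (a * _ + _)) mulrDr mulrCA.
Qed.

Lemma cup_alt f : cup f f = 0.
Proof.
apply/quotmodP; rewrite subr0; apply: lspan_in.
have /is_cocycle1P hf := valP f.
exists (fun a => - (val f a ^+ 2 / 2%:R) : rat).
have e (s t : rat) :
    s * t = - (t ^+ 2 / 2%:R) - - ((s + t) ^+ 2 / 2%:R) + - (s ^+ 2 / 2%:R).
  by field.
apply/funext=> x; apply/funext=> y; rewrite /cobar_d1 hf; exact: e.
Qed.

Lemma cup_product_map_wedge f g : cup_product_map (wedge f g) = cup f g.
Proof.
by apply: ext2_lift_wedge; [exact: cup_linl|exact: cup_linr|exact: cup_alt].
Qed.

Fact eval1_linr f : linear (eval1 f : homology1 -> rat^o).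
Proof.
move=> a; elim/quotW=> x; elim/quotW=> y.
by rewrite -linearP !eval1_pi linearP.
Qed.

Fact eval1_linl a f g z :
  eval1 (a *: f + g) z = a * eval1 f z + eval1 g z.
Proof.
rewrite /eval1 /lin_ext mulr_sumr -big_split /=; apply: eq_bigr => k _.
by rewrite -[LHS]/(_ * (a * _ + _)) mulrDr mulrCA.
Qed.

Lemma ext2_eval_wedge f g v w :
  ext2_eval (wedge f g) (wedge v w) =
  eval1 f v * eval1 g w - eval1 f w * eval1 g v.
Proof.
pose d f g v w : rat^o := eval1 f v * eval1 g w - eval1 f w * eval1 g v.
have dE f' g' : ext2_lift (d f' g') (wedge v w) = d f' g' v w.
  apply: ext2_lift_wedge => [a x y t|a x y t|x].
  - rewrite /d !eval1_linr /GRing.scale /=; ring.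
  - rewrite /d !eval1_linr /GRing.scale /=; ring.
  - exact: subrr.
rewrite /ext2_eval ext2_lift_wedge => [|a x y t|a x y t|x].
- exact: dE.
- rewrite !dE /d !eval1_linl /GRing.scale /=; ring.
- rewrite !dE /d !eval1_linl /GRing.scale /=; ring.
- by rewrite dE /d mulrC subrr.
Qed.

End BarComplex.

HB.mixin Record Lmodule_isLieAlgebra L of GRing.Lmodule rat L := {
  lie_br : L -> L -> L;
  lie_brPl : forall a x y z,
    lie_br (a *: x + y) z = a *: lie_br x z + lie_br y z;
  lie_brPr : forall a x y z,
    lie_br z (a *: x + y) = a *: lie_br z x + lie_br z y;
  lie_brxx : forall x, lie_br x x = 0;
  lie_jacobi : forall x y z,
    lie_br x (lie_br y z) + lie_br y (lie_br z x) + lie_br z (lie_br x y) = 0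
}.

#[short(type="lieAlgType")]
HB.structure Definition LieAlgebra :=
  { L of GRing.Lmodule rat L & Lmodule_isLieAlgebra L }.

Section LieTheory.
Variable L : lieAlgType.
Implicit Types x y z : L.

Lemma lie_brDl x y z : lie_br (x + y) z = lie_br x z + lie_br y z.
Proof. by rewrite -[x]scale1r lie_brPl !scale1r. Qed.
Lemma lie_brDr x y z : lie_br z (x + y) = lie_br z x + lie_br z y.
Proof. by rewrite -[x]scale1r lie_brPr !scale1r. Qed.
Lemma lie_brC x y : lie_br x y = - lie_br y x.
Proof.
apply/eqP; rewrite -addr_eq0; apply/eqP.
have := lie_brxx (x + y).
by rewrite lie_brDl !lie_brDr !lie_brxx add0r addr0.
Qed.
Lemma lie_brBl x y z : lie_br (x - y) z = lie_br x z - lie_br y z.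
Proof. by rewrite addrC -scaleN1r lie_brPl scaleN1r addrC. Qed.
Lemma lie_brBr x y z : lie_br z (x - y) = lie_br z x - lie_br z y.
Proof. by rewrite addrC -scaleN1r lie_brPr scaleN1r addrC. Qed.
End LieTheory.

Section FreeLie.
Variable V : lmodType rat.

(* The free Lie algebra on the vector space V: formal expressions modulo the
   least congruence forcing the Lie algebra axioms and the linearity of
   v |-> LieGen v. *)
Inductive lie_term : Type :=
| LieGen of V
| LieZero
| LieAdd of lie_term & lie_term
| LieScale of rat & lie_term
| LieBr of lie_term & lie_term.

HB.instance Definition _ := gen_eqMixin lie_term.
HB.instance Definition _ := gen_choiceMixin lie_term.

Inductive lie_eq : lie_term -> lie_term -> Prop :=
| lieq_refl s : lie_eq s s
| lieq_sym s t of lie_eq s t : lie_eq t s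
| lieq_trans s t u of lie_eq s t & lie_eq t u : lie_eq s u
| lieq_add s s' t t' of lie_eq s s' & lie_eq t t' :
    lie_eq (LieAdd s t) (LieAdd s' t')
| lieq_scale a s s' of lie_eq s s' : lie_eq (LieScale a s) (LieScale a s')
| lieq_br s s' t t' of lie_eq s s' & lie_eq t t' :
    lie_eq (LieBr s t) (LieBr s' t')
| lieq_addA s t u : lie_eq (LieAdd s (LieAdd t u)) (LieAdd (LieAdd s t) u)
| lieq_addC s t : lie_eq (LieAdd s t) (LieAdd t s)
| lieq_add0 s : lie_eq (LieAdd LieZero s) s
| lieq_addN s : lie_eq (LieAdd (LieScale (-1) s) s) LieZero
| lieq_scaleA a b s : lie_eq (LieScale a (LieScale b s)) (LieScale (a * b) s)
| lieq_scale1 s : lie_eq (LieScale 1 s) s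
| lieq_scaleDr a s t :
    lie_eq (LieScale a (LieAdd s t)) (LieAdd (LieScale a s) (LieScale a t))
| lieq_scaleDl a b s :
    lie_eq (LieScale (a + b) s) (LieAdd (LieScale a s) (LieScale b s))
| lieq_brl a s t u : lie_eq (LieBr (LieAdd (LieScale a s) t) u)
    (LieAdd (LieScale a (LieBr s u)) (LieBr t u))
| lieq_brr a s t u : lie_eq (LieBr u (LieAdd (LieScale a s) t))
    (LieAdd (LieScale a (LieBr u s)) (LieBr u t))
| lieq_brss s : lie_eq (LieBr s s) LieZero
| lieq_jacobi s t u : lie_eq
    (LieAdd (LieAdd (LieBr s (LieBr t u)) (LieBr t (LieBr u s)))
            (LieBr u (LieBr s t))) LieZero
| lieq_gen a v w : lie_eq (LieGen (a *: v + w))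
    (LieAdd (LieScale a (LieGen v)) (LieGen w)).

Definition free_lie := {eq_quot prop_equiv lieq_refl lieq_sym lieq_trans}.
HB.instance Definition _ := Choice.on free_lie.
HB.instance Definition _ := EqQuotient.on free_lie.

Lemma free_lieP s t : s = t %[mod free_lie] <-> lie_eq s t.
Proof. exact: prop_quotP. Qed.

Let repr_lieq s : lie_eq (repr (\pi_free_lie s)) s.
Proof. by apply/free_lieP; rewrite reprK. Qed.

Definition fl_zero : free_lie := \pi_free_lie LieZero.
Definition fl_scale a (x : free_lie) : free_lie :=
  \pi_free_lie (LieScale a (repr x)).
Definition fl_opp (x : free_lie) : free_lie := fl_scale (-1) x.
Definition fl_add (x y : free_lie) : free_lie :=
  \pi_free_lie (LieAdd (repr x) (repr y)).
Definition fl_br (x y : free_lie) : free_lie :=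
  \pi_free_lie (LieBr (repr x) (repr y)).

Let scaleE a s : fl_scale a (\pi_free_lie s) = \pi_free_lie (LieScale a s).
Proof. exact/free_lieP/lieq_scale/repr_lieq. Qed.
Let addE s t :
  fl_add (\pi_free_lie s) (\pi_free_lie t) = \pi_free_lie (LieAdd s t).
Proof. by apply/free_lieP/lieq_add; apply: repr_lieq. Qed.
Let brE s t :
  fl_br (\pi_free_lie s) (\pi_free_lie t) = \pi_free_lie (LieBr s t).
Proof. by apply/free_lieP/lieq_br; apply: repr_lieq. Qed.

Let addA : associative fl_add.
Proof.
elim/quotW=> x; elim/quotW=> y; elim/quotW=> z.
by rewrite (addE x y) (addE y z) !addE; apply/free_lieP/lieq_addA.
Qed.
Let addC : commutative fl_add.
Proof.
by elim/quotW=> x; elim/quotW=> y; rewrite !addE; apply/free_lieP/lieq_addC.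
Qed.
Let add0 : left_id fl_zero fl_add.
Proof. by elim/quotW=> x; rewrite addE; apply/free_lieP/lieq_add0. Qed.
Let addN : left_inverse fl_zero fl_opp fl_add.
Proof.
by elim/quotW=> x; rewrite /fl_opp (scaleE _ x) addE; apply/free_lieP/lieq_addN.
Qed.

HB.instance Definition _ := GRing.isZmodule.Build free_lie addA addC add0 addN.

Let scaleA a b x : fl_scale a (fl_scale b x) = fl_scale (a * b) x.
Proof.
elim/quotW: x => x; rewrite (scaleE b x) !scaleE.
exact/free_lieP/lieq_scaleA.
Qed.
Let scale1 : left_id 1 fl_scale.
Proof. by elim/quotW=> x; rewrite scaleE; apply/free_lieP/lieq_scale1. Qed.
Let scaleDr : right_distributive fl_scale +%R.
Proof.
move=> a; elim/quotW=> x; elim/quotW=> y.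
rewrite -[X in fl_scale a X]/(fl_add _ _) -[RHS]/(fl_add _ _).
rewrite (addE x y) (scaleE a x) (scaleE a y) addE scaleE.
exact/free_lieP/lieq_scaleDr.
Qed.
Let scaleDl x : {morph fl_scale^~ x : a b / a + b}.
Proof.
elim/quotW: x => x a b; rewrite /= -[RHS]/(fl_add _ _).
rewrite (scaleE a x) (scaleE b x) addE scaleE.
exact/free_lieP/lieq_scaleDl.
Qed.

HB.instance Definition _ :=
  GRing.Zmodule_isLmodule.Build rat free_lie scaleA scale1 scaleDr scaleDl.

Let linE a s t : a *: \pi_free_lie s + \pi_free_lie t =
  \pi_free_lie (LieAdd (LieScale a s) t) :> free_lie.
Proof. by rewrite -[LHS]/(fl_add (fl_scale _ _) _) (scaleE a s) addE. Qed.

Let brPl a x y z : fl_br (a *: x + y) z = a *: fl_br x z + fl_br y z.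
Proof.
elim/quotW: x => x; elim/quotW: y => y; elim/quotW: z => z.
rewrite (linE a x y) (brE x z) (brE y z) brE linE.
exact/free_lieP/lieq_brl.
Qed.
Let brPr a x y z : fl_br z (a *: x + y) = a *: fl_br z x + fl_br z y.
Proof.
elim/quotW: x => x; elim/quotW: y => y; elim/quotW: z => z.
rewrite (linE a x y) (brE z x) (brE z y) brE linE.
exact/free_lieP/lieq_brr.
Qed.
Let brxx x : fl_br x x = 0.
Proof. by elim/quotW: x => x; rewrite brE; apply/free_lieP/lieq_brss. Qed.
Let jacobi x y z :
  fl_br x (fl_br y z) + fl_br y (fl_br z x) + fl_br z (fl_br x y) = 0.
Proof.
elim/quotW: x => x; elim/quotW: y => y; elim/quotW: z => z.
rewrite (brE y z) (brE z x) (brE x y) !brE.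
rewrite -[LHS]/(fl_add (fl_add _ _) _) (addE (LieBr x _)) addE.
exact/free_lieP/lieq_jacobi.
Qed.

HB.instance Definition _ :=
  Lmodule_isLieAlgebra.Build free_lie brPl brPr brxx jacobi.

Definition lie_gen (v : V) : free_lie := \pi_free_lie (LieGen v).

Lemma lie_gen_linear : linear lie_gen.
Proof. by move=> a v w; rewrite linE; apply/free_lieP/lieq_gen. Qed.

(* The homogeneous component lie_k(V), with V in degree 1. *)
Inductive free_lie_deg : nat -> free_lie -> Prop :=
| fld_0 k : free_lie_deg k 0
| fld_lin k a x y of free_lie_deg k x & free_lie_deg k y :
    free_lie_deg k (a *: x + y)
| fld_gen v : free_lie_deg 1 (lie_gen v)
| fld_br i j x y of free_lie_deg i x & free_lie_deg j y :
    free_lie_deg (i + j) (lie_br x y).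

Definition ext2_to_lie : ext2 V -> free_lie :=
  ext2_lift (fun v w => lie_br (lie_gen v) (lie_gen w)).

Lemma ext2_to_lie_wedge v w :
  ext2_to_lie (wedge v w) = lie_br (lie_gen v) (lie_gen w).
Proof.
apply: ext2_lift_wedge => [a x y z|a x y z|x].
- by rewrite lie_gen_linear lie_brPl.
- by rewrite lie_gen_linear lie_brPr.
- exact: lie_brxx.
Qed.

End FreeLie.

Section LieQuotient.
Variables (L : lieAlgType) (S : set L).

Inductive lie_ideal : L -> Prop :=
| li_0 : lie_ideal 0
| li_in x of S x : lie_ideal x
| li_lin a x y of lie_ideal x & lie_ideal y : lie_ideal (a *: x + y)
| li_br x y of lie_ideal y : lie_ideal (lie_br x y).

Definition lie_quot := quotmod lie_ideal.
HB.instance Definition _ := GRing.Lmodule.on lie_quot.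
HB.instance Definition _ := EqQuotient.on lie_quot.

Lemma lie_quotP x y : x = y %[mod lie_quot] <-> lie_ideal (x - y).
Proof.
split=> [/quotmodP h|h]; last exact/quotmodP/lspan_in.
by elim: h => [|a u v hu _ hv]; [exact: li_0|exact: li_lin].
Qed.

Let repr_li x : lie_ideal (repr (\pi_lie_quot x) - x).
Proof. by apply/lie_quotP; rewrite reprK. Qed.

Definition lq_br (x y : lie_quot) : lie_quot :=
  \pi_lie_quot (lie_br (repr x) (repr y)).

Let brE x y :
  lq_br (\pi_lie_quot x) (\pi_lie_quot y) = \pi_lie_quot (lie_br x y).
Proof.
apply/lie_quotP; set x' := repr _; set y' := repr _.
have -> : lie_br x' y' - lie_br x y =
    (-1) *: lie_br y' (x' - x) + lie_br x (y' - y).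
  rewrite !lie_brBr scaleN1r opprB (lie_brC x' y') (lie_brC x y').
  by rewrite addrACA subrr add0r.
by apply: li_lin; apply: li_br; exact: repr_li.
Qed.

Let piP a x y : a *: \pi_lie_quot x + \pi_lie_quot y =
  \pi_lie_quot (a *: x + y) :> lie_quot.
Proof. exact/esym/quotmod_pi_linear. Qed.
Let piD x y :
  \pi_lie_quot x + \pi_lie_quot y = \pi_lie_quot (x + y) :> lie_quot.
Proof. by rewrite -[x]scale1r -piP !scale1r. Qed.

Let brPl a x y z : lq_br (a *: x + y) z = a *: lq_br x z + lq_br y z.
Proof.
elim/quotW: x => x; elim/quotW: y => y; elim/quotW: z => z.
by rewrite (piP a x y) (brE x z) (brE y z) brE piP lie_brPl.
Qed.
Let brPr a x y z : lq_br z (a *: x + y) = a *: lq_br z x + lq_br z y.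
Proof.
elim/quotW: x => x; elim/quotW: y => y; elim/quotW: z => z.
by rewrite (piP a x y) (brE z x) (brE z y) brE piP lie_brPr.
Qed.
Let brxx x : lq_br x x = 0.
Proof.
by elim/quotW: x => x; rewrite brE lie_brxx
  -[LHS](linear0 \pi_(quotmod lie_ideal)).
Qed.
Let jacobi x y z :
  lq_br x (lq_br y z) + lq_br y (lq_br z x) + lq_br z (lq_br x y) = 0.
Proof.
elim/quotW: x => x; elim/quotW: y => y; elim/quotW: z => z.
rewrite (brE y z) (brE z x) (brE x y) !brE.
by rewrite piD (piD (_ + _)) lie_jacobi -[LHS](linear0 \pi_(quotmod lie_ideal)).
Qed.

HB.instance Definition _ :=
  Lmodule_isLieAlgebra.Build lie_quot brPl brPr brxx jacobi.

End LieQuotient.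

Section Enveloping.
Variable L : lieAlgType.

(* U(L): formal expressions modulo the least congruence forcing the axioms of
   unital associative algebras, the linearity of x |-> EnvGen x and
   [x, y] = x y - y x. *)
Inductive env_term : Type :=
| EnvGen of L
| EnvZero
| EnvOne
| EnvAdd of env_term & env_term
| EnvScale of rat & env_term
| EnvMul of env_term & env_term.

HB.instance Definition _ := gen_eqMixin env_term.
HB.instance Definition _ := gen_choiceMixin env_term.

Inductive env_eq : env_term -> env_term -> Prop :=
| ee_refl s : env_eq s s
| ee_sym s t of env_eq s t : env_eq t s
| ee_trans s t u of env_eq s t & env_eq t u : env_eq s u
| ee_add s s' t t' of env_eq s s' & env_eq t t' :
    env_eq (EnvAdd s t) (EnvAdd s' t')
| ee_scale a s s' of env_eq s s' : env_eq (EnvScale a s) (EnvScale a s')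
| ee_mul s s' t t' of env_eq s s' & env_eq t t' :
    env_eq (EnvMul s t) (EnvMul s' t')
| ee_addA s t u : env_eq (EnvAdd s (EnvAdd t u)) (EnvAdd (EnvAdd s t) u)
| ee_addC s t : env_eq (EnvAdd s t) (EnvAdd t s)
| ee_add0 s : env_eq (EnvAdd EnvZero s) s
| ee_addN s : env_eq (EnvAdd (EnvScale (-1) s) s) EnvZero
| ee_scaleA a b s : env_eq (EnvScale a (EnvScale b s)) (EnvScale (a * b) s)
| ee_scale1 s : env_eq (EnvScale 1 s) s
| ee_scaleDr a s t :
    env_eq (EnvScale a (EnvAdd s t)) (EnvAdd (EnvScale a s) (EnvScale a t))
| ee_scaleDl a b s :
    env_eq (EnvScale (a + b) s) (EnvAdd (EnvScale a s) (EnvScale b s))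
| ee_mulA s t u : env_eq (EnvMul s (EnvMul t u)) (EnvMul (EnvMul s t) u)
| ee_mul1l s : env_eq (EnvMul EnvOne s) s
| ee_mul1r s : env_eq (EnvMul s EnvOne) s
| ee_mulDl s t u :
    env_eq (EnvMul (EnvAdd s t) u) (EnvAdd (EnvMul s u) (EnvMul t u))
| ee_mulDr s t u :
    env_eq (EnvMul u (EnvAdd s t)) (EnvAdd (EnvMul u s) (EnvMul u t))
| ee_scaleAl a s t : env_eq (EnvScale a (EnvMul s t)) (EnvMul (EnvScale a s) t)
| ee_scaleAr a s t : env_eq (EnvScale a (EnvMul s t)) (EnvMul s (EnvScale a t))
| ee_gen a x y : env_eq (EnvGen (a *: x + y))
    (EnvAdd (EnvScale a (EnvGen x)) (EnvGen y))
| ee_br x y : env_eq (EnvGen (lie_br x y))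
    (EnvAdd (EnvMul (EnvGen x) (EnvGen y))
            (EnvScale (-1) (EnvMul (EnvGen y) (EnvGen x)))).

Definition envelope := {eq_quot prop_equiv ee_refl ee_sym ee_trans}.
HB.instance Definition _ := Choice.on envelope.
HB.instance Definition _ := EqQuotient.on envelope.

Lemma envelopeP s t : s = t %[mod envelope] <-> env_eq s t.
Proof. exact: prop_quotP. Qed.

Let repr_ee s : env_eq (repr (\pi_envelope s)) s.
Proof. by apply/envelopeP; rewrite reprK. Qed.

Definition env_zero : envelope := \pi_envelope EnvZero.
Definition env_one : envelope := \pi_envelope EnvOne.
Definition env_scale a (x : envelope) : envelope :=
  \pi_envelope (EnvScale a (repr x)).
Definition env_opp (x : envelope) : envelope := env_scale (-1) x.
Definition env_add (x y : envelope) : envelope :=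
  \pi_envelope (EnvAdd (repr x) (repr y)).
Definition env_mul (x y : envelope) : envelope :=
  \pi_envelope (EnvMul (repr x) (repr y)).

Let scaleE a s : env_scale a (\pi_envelope s) = \pi_envelope (EnvScale a s).
Proof. exact/envelopeP/ee_scale/repr_ee. Qed.
Let addE s t :
  env_add (\pi_envelope s) (\pi_envelope t) = \pi_envelope (EnvAdd s t).
Proof. by apply/envelopeP/ee_add; apply: repr_ee. Qed.
Let mulE s t :
  env_mul (\pi_envelope s) (\pi_envelope t) = \pi_envelope (EnvMul s t).
Proof. by apply/envelopeP/ee_mul; apply: repr_ee. Qed.

Let addA : associative env_add.
Proof.
elim/quotW=> x; elim/quotW=> y; elim/quotW=> z.
by rewrite (addE x y) (addE y z) !addE; apply/envelopeP/ee_addA.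
Qed.
Let addC : commutative env_add.
Proof.
by elim/quotW=> x; elim/quotW=> y; rewrite !addE; apply/envelopeP/ee_addC.
Qed.
Let add0 : left_id env_zero env_add.
Proof. by elim/quotW=> x; rewrite addE; apply/envelopeP/ee_add0. Qed.
Let addN : left_inverse env_zero env_opp env_add.
Proof.
by elim/quotW=> x; rewrite /env_opp (scaleE _ x) addE; apply/envelopeP/ee_addN.
Qed.

HB.instance Definition _ := GRing.isZmodule.Build envelope addA addC add0 addN.

Let mulA : associative env_mul.
Proof.
elim/quotW=> x; elim/quotW=> y; elim/quotW=> z.
by rewrite (mulE x y) (mulE y z) !mulE; apply/envelopeP/ee_mulA.
Qed.
Let mul1l : left_id env_one env_mul.
Proof. by elim/quotW=> x; rewrite mulE; apply/envelopeP/ee_mul1l. Qed.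
Let mul1r : right_id env_one env_mul.
Proof. by elim/quotW=> x; rewrite mulE; apply/envelopeP/ee_mul1r. Qed.
Let mulDl : left_distributive env_mul +%R.
Proof.
elim/quotW=> x; elim/quotW=> y; elim/quotW=> z.
rewrite -[x in env_mul x _]/(env_add _ _) -[RHS]/(env_add _ _).
rewrite (addE x y) (mulE x z) (mulE y z) addE mulE.
exact/envelopeP/ee_mulDl.
Qed.
Let mulDr : right_distributive env_mul +%R.
Proof.
elim/quotW=> z; elim/quotW=> x; elim/quotW=> y.
rewrite -[x in env_mul _ x]/(env_add _ _) -[RHS]/(env_add _ _).
rewrite (addE x y) (mulE z x) (mulE z y) addE mulE.
exact/envelopeP/ee_mulDr.
Qed.

(* The augmentation, which shows that U(L) is not trivial. *)
Fixpoint env_augment (s : env_term) : rat :=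
  match s with
  | EnvGen _ | EnvZero => 0
  | EnvOne => 1
  | EnvAdd s t => env_augment s + env_augment t
  | EnvScale a s => a * env_augment s
  | EnvMul s t => env_augment s * env_augment t
  end.

Let augment_eq s t : env_eq s t -> env_augment s = env_augment t.
Proof.
elim=> {s t} /=; try by [move=> *; ring | move=> * ; congruence].
Qed.

Let one_neq0 : env_one != 0 :> envelope.
Proof.
apply/negP => /eqP /envelopeP /augment_eq /= /eqP.
by rewrite oner_eq0.
Qed.

HB.instance Definition _ :=
  GRing.Zmodule_isNzRing.Build envelope mulA mul1l mul1r mulDl mulDr one_neq0.

Let scaleA a b x : env_scale a (env_scale b x) = env_scale (a * b) x.
Proof.
elim/quotW: x => x; rewrite (scaleE b x) !scaleE.
exact/envelopeP/ee_scaleA.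
Qed.
Let scale1 : left_id 1 env_scale.
Proof. by elim/quotW=> x; rewrite scaleE; apply/envelopeP/ee_scale1. Qed.
Let scaleDr : right_distributive env_scale +%R.
Proof.
move=> a; elim/quotW=> x; elim/quotW=> y.
rewrite -[X in env_scale a X]/(env_add _ _) -[RHS]/(env_add _ _).
rewrite (addE x y) (scaleE a x) (scaleE a y) addE scaleE.
exact/envelopeP/ee_scaleDr.
Qed.
Let scaleDl x : {morph env_scale^~ x : a b / a + b}.
Proof.
elim/quotW: x => x a b; rewrite /= -[RHS]/(env_add _ _).
rewrite (scaleE a x) (scaleE b x) addE scaleE.
exact/envelopeP/ee_scaleDl.
Qed.

HB.instance Definition _ :=
  GRing.Zmodule_isLmodule.Build rat envelope scaleA scale1 scaleDr scaleDl.

Let scaleAl a (x y : envelope) : a *: (x * y) = a *: x * y.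
Proof.
elim/quotW: x => x; elim/quotW: y => y.
rewrite -[LHS]/(env_scale a (env_mul _ _)).
rewrite -[RHS]/(env_mul (env_scale a _) _).
rewrite (mulE x y) (scaleE a x) scaleE mulE.
exact/envelopeP/ee_scaleAl.
Qed.
HB.instance Definition _ :=
  GRing.Lmodule_isLalgebra.Build rat envelope scaleAl.

Let scaleAr a (x y : envelope) : a *: (x * y) = x * (a *: y).
Proof.
elim/quotW: x => x; elim/quotW: y => y.
rewrite -[LHS]/(env_scale a (env_mul _ _)).
rewrite -[RHS]/(env_mul _ (env_scale a _)).
rewrite (mulE x y) (scaleE a y) scaleE mulE.
exact/envelopeP/ee_scaleAr.
Qed.
HB.instance Definition _ :=
  GRing.Lalgebra_isAlgebra.Build rat envelope scaleAr.

Definition env_gen (x : L) : envelope := \pi_envelope (EnvGen x).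

Lemma env_gen_linear : linear env_gen.
Proof.
move=> a x y; rewrite -[RHS]/(env_add (env_scale a _) _).
by rewrite (scaleE a (EnvGen x)) addE; apply/envelopeP/ee_gen.
Qed.

Lemma env_gen_br x y :
  env_gen (lie_br x y) = env_gen x * env_gen y - env_gen y * env_gen x.
Proof.
rewrite -[RHS]/(env_add (env_mul _ _) (env_opp (env_mul _ _))) /env_opp.
rewrite (mulE (EnvGen x)) (mulE (EnvGen y)) scaleE addE.
exact/envelopeP/ee_br.
Qed.

(* The grading of U(L) induced by a grading gr of L: the degree k part is
   spanned by the products x_1 ... x_m with x_i in L_{k_i} and
   k_1 + ... + k_m = k. *)
Inductive envelope_deg (gr : nat -> set L) : nat -> envelope -> Prop :=
| evd_0 k : envelope_deg gr k 0
| evd_lin k a x y of envelope_deg gr k x & envelope_deg gr k y :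
    envelope_deg gr k (a *: x + y)
| evd_1 : envelope_deg gr 0 1
| evd_gen k x of gr k x : envelope_deg gr k (env_gen x)
| evd_mul i j x y of envelope_deg gr i x & envelope_deg gr j y :
    envelope_deg gr (i + j) (x * y).

End Enveloping.

Section Holonomy.
Variable G : groupType.

Definition holonomy : lieAlgType :=
  lie_quot (fun x : free_lie (homology1 G) =>
    exists w, im_dual_cup w /\ x = ext2_to_lie w).

(* The ideal is homogeneous, so h(G) is graded by the images of lie_k. *)
Definition holonomy_deg (k : nat) : set holonomy :=
  fun x => exists y : free_lie (homology1 G),
    free_lie_deg k y /\ x = \pi_(lie_quot _) y.

End Holonomy.

Definition has_dim (V : lmodType rat) (W : set V) (d : nat) : Prop :=
  exists b : 'I_d -> V,
    (forall c : 'I_d -> rat, \sum_i c i *: b i = 0 -> forall i, c i = 0) /\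
    (forall v, W v <-> exists c : 'I_d -> rat, v = \sum_i c i *: b i).

(* Formal power series over Q are represented by their coefficients:
   [is_hilb gr s] says that every gr k is finite-dimensional and that
   Hilb(gr; t) = \sum_k dim (gr k) t^k = \sum_k s k t^k. *)
Definition is_hilb (V : lmodType rat) (gr : nat -> set V) (s : nat -> rat) :
    Prop :=
  forall k, exists d : nat, has_dim (gr k) d /\ s k = d%:R.

(* The power series 1 / p, for p with constant term 1: the coefficient of t^k
   in \sum_j (1 - p)^j, to which the terms with j > k do not contribute. *)
Definition fps_inv (p : {poly rat}) (k : nat) : rat :=
  (\sum_(j < k.+1) (1 - p) ^+ j)`_k.

Lemma fps_mulVp (p : {poly rat}) : p`_0 = 1 ->
  forall k, \sum_(i < k.+1) fps_inv p i * p`_(k - i) = (k == 0%N)%:R.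
Proof.
move=> p0 k; set q := 1 - p.
have q_low (m : nat) j : (m < j)%N -> (q ^+ j)`_m = 0.
  have : q`_0 = 0 by rewrite coefB coef1 p0 subrr.
  move/eqP; rewrite -horner_coef0 => /factor_theorem [u ->].
  rewrite subr0 exprMn_comm; last exact: mulrC.
  by move=> lt; rewrite coefMXn lt.
have invE (i : 'I_k.+1) : fps_inv p i = (\sum_(j < k.+1) q ^+ j)`_i.
  rewrite /fps_inv -/q !coef_sum.
  rewrite -!(big_mkord xpredT (fun j => (q ^+ j)`_i)).
  rewrite [RHS](big_cat_nat (leq0n i.+1) (ltn_ord i)) /=.
  rewrite [X in _ + X]big_nat_cond [X in _ + X]big1 ?addr0 //.
  by move=> j /andP [/andP [lt _] _]; exact: q_low.
under eq_bigr do rewrite invE.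
rewrite -coefM.
have -> : p = 1 - q by rewrite /q opprB addrC subrK.
rewrite mulrC -opprB mulNr -subrX1 opprB coefB q_low // subr0.
by rewrite coef1.
Qed.

(* Main.v *)
(* Idea: h(G) is presented by H_1(G; Q) in degree 1 and by the image of H_2(G; Q)
   in degree 2, and that image is controlled by the degree 2 Magnus coefficients
   of r.  Write G = F/R.  If f, g : G -> Q are homomorphisms, then mu_fg, the
   combination of degree 2 Magnus coefficients attached to f and g, satisfies
   mu_fg(xy) = mu_fg(x) + mu_fg(y) + f(x) g(y) on F: the cup product of f and g
   becomes a coboundary on F, and mu_fg restricts to an F-invariant homomorphism
   on R.  Hence f cup g takes on a 2-cycle of G the value lam * mu_fg(r), with lam
   independent of f and g; moreover lam = 0 if r is not in [F, F], every value is
   0 if r is in Gamma_3 F, and for r in [F, F] the value lam = 1 is attained.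
   Finally, mu_fg(r) is not identically 0 if r is in Gamma_2 F but not in
   Gamma_3 F.

   So h(G) is free on n - 1 or n generators, or is the quotient of the free Lie
   algebra by one element rho = sum_(i < j) c_ij [x_i, x_j] with c_ab != 0.  In
   the last case, rho allows one to rewrite the word x_a x_b, which does not
   overlap itself; so the words avoiding x_a x_b form a basis of U(h(G)), which
   is checked by letting U(h(G)) act on the span of all words. *)
Require Import Defs.
From mathcomp Require Import all_boot all_algebra.
From mathcomp Require Import boolp classical_sets functions.
From mathcomp Require Import finmap monalg ring lra.

Set Implicit Arguments.
Unset Strict Implicit.
Unset Printing Implicit Defensive.

Import GRing.Theory Num.Theory.
Local Open Scope quotient_scope.
Local Open Scope ring_scope.

(** * Exponent sums and degree 2 Magnus coefficients *)

Section MagnusCoefficients.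
Variable n : nat.
Local Notation F := (free_group n).
Implicit Types (f g : 'I_n -> rat) (u v w : word n) (x y : F).

Definition letter_sum f (a : letter n) : rat := if a.2 then - f a.1 else f a.1.
(** In the Magnus expansion x_i maps to 1 + X_i and x_i^-1 to 1 - X_i + X_i^2 - ..., so only inverse
    letters have a degree 2 term. *)
Definition letter_magnus f g (a : letter n) : rat :=
  if a.2 then f a.1 * g a.1 else 0.

Fixpoint word_sum f w : rat :=
  if w is a :: w' then letter_sum f a + word_sum f w' else 0.
Fixpoint word_magnus f g w : rat :=
  if w is a :: w' then
    letter_magnus f g a + letter_sum f a * word_sum g w' + word_magnus f g w'
  else 0.

Lemma word_sum_cat f u v : word_sum f (u ++ v) = word_sum f u + word_sum f v.
Proof. by elim: u => [|a u ih] /=; rewrite ?add0r // ih addrA. Qed.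

Lemma word_magnus_cat f g u v :
  word_magnus f g (u ++ v) =
  word_magnus f g u + word_magnus f g v + word_sum f u * word_sum g v.
Proof.
elim: u => [|a u ih] /=; first by rewrite mul0r addr0 add0r.
by rewrite ih word_sum_cat; ring.
Qed.

Lemma word_sum_eq f u v : word_eq u v -> word_sum f u = word_sum f v.
Proof.
elim=> {u v} [//|u v _ //|u v w _ -> _ -> //|u [i []] v].
- by rewrite !word_sum_cat /= /letter_sum /=; ring.
- by rewrite !word_sum_cat /= /letter_sum /=; ring.
Qed.

Lemma word_magnus_eq f g u v :
  word_eq u v -> word_magnus f g u = word_magnus f g v.
Proof.
elim=> {u v} [//|u v _ //|u v w _ -> _ -> //|u [i []] v];
rewrite !word_magnus_cat /= /letter_sum /letter_magnus /=; ring.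
Qed.

(* For f, g : F -> Q the homomorphisms with values f i, g i on x_i, the number
   [magnus f g x] is sum_ij f_i g_j mu_ij(x), where mu_ij(x) is the coefficient
   of X_i X_j in the Magnus expansion of x. *)
Definition fsum f x : rat := word_sum f (repr x).
Definition magnus f g x : rat := word_magnus f g (repr x).

Lemma fsum_pi f w : fsum f (\pi_(free_group n) w) = word_sum f w.
Proof. by apply/word_sum_eq/free_groupP; rewrite reprK. Qed.

Lemma magnus_pi f g w : magnus f g (\pi_(free_group n) w) = word_magnus f g w.
Proof. by apply/word_magnus_eq/free_groupP; rewrite reprK. Qed.

Lemma fsumM f x y : fsum f (x * y)%g = fsum f x + fsum f y.
Proof.
elim/quotW: x => u; elim/quotW: y => v.
by rewrite -free_group_piM !fsum_pi word_sum_cat.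
Qed.

Lemma magnusM f g x y : magnus f g (x * y)%g =
  magnus f g x + magnus f g y + fsum f x * fsum g y.
Proof.
elim/quotW: x => u; elim/quotW: y => v.
by rewrite -free_group_piM !magnus_pi !fsum_pi word_magnus_cat.
Qed.

Lemma fsum1 f : fsum f 1%g = 0.
Proof. by rewrite -[1%g]/(\pi_(free_group n) [::]) fsum_pi. Qed.

Lemma magnus1 f g : magnus f g 1%g = 0.
Proof. by rewrite -[1%g]/(\pi_(free_group n) [::]) magnus_pi. Qed.

Lemma fsumV f x : fsum f x^-1%g = - fsum f x.
Proof. by apply/eqP; rewrite -addr_eq0 -fsumM mulVg fsum1. Qed.

Lemma magnusV f g x :
  magnus f g x^-1%g = - magnus f g x + fsum f x * fsum g x.
Proof.
have := magnusM f g x^-1%g x; rewrite mulVg magnus1 fsumV => /eqP.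
rewrite eq_sym addr_eq0 mulNr opprK => /eqP h.
by rewrite -h; ring.
Qed.

Lemma fsum_gen f i : fsum f (free_gen i) = f i.
Proof. by rewrite fsum_pi /= /letter_sum addr0. Qed.

Lemma magnus_gen f g i : magnus f g (free_gen i) = 0.
Proof. by rewrite magnus_pi /= /letter_magnus mulr0 !addr0. Qed.

Lemma free_group_ind (P : F -> Prop) :
  P 1%g -> (forall i, P (free_gen i)) -> (forall i, P (free_gen i)^-1%g) ->
  (forall x y, P x -> P y -> P (x * y)%g) -> forall x, P x.
Proof.
move=> P1 Pg PV PM x; elim/quotW: x; elim=> [|[i b] w ih]; first exact: P1.
rewrite -cat1s free_group_piM; apply: PM => //.
by case: b; [rewrite free_group_piV; exact: PV|exact: Pg].
Qed.

Lemma free_group_hom0 (V : zmodType) (psi : F -> V) :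
    (forall x y, psi (x * y)%g = psi x + psi y) ->
  (forall i, psi (free_gen i) = 0) -> forall x, psi x = 0.
Proof.
move=> psiM h.
have psi1 : psi 1%g = 0.
  by apply: (addrI (psi 1%g)); rewrite -psiM mulg1 addr0.
apply: free_group_ind => [//|//|i|x y hx hy]; last by rewrite psiM hx hy addr0.
by have := psiM (free_gen i) (free_gen i)^-1%g; rewrite mulgV psi1 h add0r.
Qed.

Lemma fsum_hom f (psi : F -> rat) :
    (forall x y, psi (x * y)%g = psi x + psi y) ->
  (forall i, psi (free_gen i) = f i) -> psi =1 fsum f.
Proof.
move=> psiM h x; apply/eqP; rewrite -subr_eq0; apply/eqP.
apply: (@free_group_hom0 _ (fun x => psi x - fsum f x)) => // [y z|i].
  by rewrite psiM fsumM; ring.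
by rewrite h fsum_gen subrr.
Qed.

Lemma fsum_commg f x y : fsum f [~ x, y]%g = 0.
Proof. by rewrite commgEl !fsumM !fsumV; ring. Qed.

(** Compare both sides of xy = yx[x, y]: the mixed term involving [x, y] vanishes because exponent
    sums kill commutators. *)
Lemma magnus_commg f g x y :
  magnus f g [~ x, y]%g = fsum f x * fsum g y - fsum f y * fsum g x.
Proof.
have := congr1 (magnus f g) (commgC x y).
rewrite !magnusM fsum_commg; lra.
Qed.

End MagnusCoefficients.

(** * Lower central quotients and their coordinates *)

Section CommutingProducts.
Local Open Scope group_scope.
Variables (Q : groupType) (I : finType) (y : I -> Q).
Hypothesis yC : forall i j, commute (y i) (y j).

Let P (m : I -> nat) : Q := \big[*%g/1]_i y i ^+ m i.

Let PC m1 m2 : commute (P m1) (P m2).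
Proof.
apply: commute_prod => i _; apply/commute_sym/commute_prod => j _.
exact: commuteX2.
Qed.

Let PD m1 m2 : P (fun i => (m1 i + m2 i)%N) = P m1 * P m2.
Proof.
rewrite /P -prodgM_commute => [|i j _ _]; last exact: commuteX2.
by apply: eq_bigr => i _; rewrite expgnDr.
Qed.

(** Commutativity lets the factors be collected; integer exponents are written as differences of
    natural ones. *)
Lemma commuting_span x : subgroup_gen (range y) x ->
  exists m1 m2 : I -> nat, x = P m1 * (P m2)^-1.
Proof.
elim=> {x} [|x [i _ <-]|x x' _ [a [b ->]] _ [c [d ->]]|x _ [a [b ->]]].
- by exists (fun=> 0%N), (fun=> 0%N); rewrite mulgV.
- exists (fun j => (j == i : nat)), (fun=> 0%N).
  rewrite /P [X in _ / X]big1 // invg1 mulg1.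
  under eq_bigr do rewrite expgb.
  by rewrite -big_mkcond big_pred1_eq.
- exists (fun i => (a i + c i)%N), (fun i => (b i + d i)%N).
  rewrite !PD invgM -!mulgA; congr (_ * _).
  have cV m1 m2 : commute (P m1)^-1 (P m2) by apply/commute_sym/commuteV/PC.
  by rewrite [LHS]mulgA (cV b c) -mulgA -!invgM PC.
- by exists b, a; rewrite invgM invgK.
Qed.

End CommutingProducts.

Section QuotientMorphism.
Local Open Scope group_scope.
Variables (F : groupType) (S : set F).
Local Notation pi := (\pi_(quotient_group S)).
Implicit Types x y : F.

Lemma quotient_pi1 : pi 1 = 1.
Proof. by []. Qed.

Lemma quotient_piV x : pi x^-1 = (pi x)^-1.
Proof.
by apply: (mulgI (pi x)); rewrite mulgV -quotient_group_piM mulgV quotient_pi1.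
Qed.

Lemma quotient_piR x y : pi [~ x, y] = [~ pi x, pi y].
Proof. by rewrite commgEl /conjg !quotient_group_piM !quotient_piV. Qed.
End QuotientMorphism.

Section LowerCentral.
Local Open Scope group_scope.
Variable F : groupType.
Implicit Types x y z : F.

Lemma lower_central_commg k x y : (0 < k)%N ->
  lower_central k x -> lower_central k.+1 [~ x, y].
Proof. by case: k => // k _ hx; apply: sg_in; exists x, y. Qed.

Lemma lower_central_subgroup k x :
  subgroup_gen (lower_central k) x -> lower_central k x.
Proof.
case: k => [|[|k]] //; elim=> {x} [|//|x y _ hx _ hy|x _ hx].
- exact: sg_1.
- exact: sg_M.
- exact: sg_V.
Qed.

Lemma lower_central1 k : lower_central k (1 : F).
Proof. exact/lower_central_subgroup/sg_1. Qed.
Lemma lower_centralM k x y :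
  lower_central k x -> lower_central k y -> lower_central k (x * y).
Proof.
by move=> hx hy; apply/lower_central_subgroup/sg_M; exact: sg_in.
Qed.
Lemma lower_centralV k x : lower_central k x -> lower_central k x^-1.
Proof. by move=> hx; apply/lower_central_subgroup/sg_V; exact: sg_in. Qed.

Lemma lower_centralJ k x z : lower_central k x -> lower_central k (x ^ z).
Proof.
case: k => // k; elim: k x z => // k ih x z.
elim=> {x} [|_ [x [y [hx ->]]]|x y _ hx _ hy|x _ hx].
- by rewrite conj1g; exact: lower_central1.
- by rewrite conjRg; apply: lower_central_commg => //; exact: ih.
- by rewrite conjMg; exact: lower_centralM.
- by rewrite conjVg; exact: lower_centralV.
Qed.

Lemma lower_central_normal k x :
  normal_closure (lower_central k) x -> lower_central k x.
Proof.
elim=> {x} [|//|x y _ hx _ hy|x _ hx|x y _ hx].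
- exact: lower_central1.
- exact: lower_centralM.
- exact: lower_centralV.
- exact: lower_centralJ.
Qed.

Lemma lower_centralS k x : lower_central k.+1 x -> lower_central k x.
Proof.
elim: k x => [//|k ih] x; case: k ih => // k ih.
elim=> {x} [|_ [x [y [hx ->]]]|x y _ hx _ hy|x _ hx].
- exact: lower_central1.
- by apply: lower_central_commg => //; exact: ih.
- exact: lower_centralM.
- exact: lower_centralV.
Qed.

Lemma lower_central_le j k x :
  (j <= k)%N -> lower_central k x -> lower_central j x.
Proof.
move=> /subnK <-; elim: (k - j)%N => [//|d ih] h.
exact/ih/lower_centralS.
Qed.

Lemma weight_ge_lower_central m x :
  weight_ge m.+1 x -> lower_central m.+1 x.
Proof.
rewrite /weight_ge; case e: (weight x) => [k|].
  move/weight_SomeP: e => [_ hk _] mk; exact: lower_central_le hk.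
move=> _; apply: contrapT => nx.
(* If x left the series by index m + 1, the last term containing it would give a maximal depth,
   against infinite weight. *)
have [k] : exists k, is_max_depth x k; last first.
  by move/weight_SomeP; rewrite e.
elim: m nx => [|m ih] nx; first by case: nx.
have [hx|] := pselect (lower_central m.+1 x); last exact: ih.
exists m.+1; split=> // j _ hj; rewrite leqNgt; apply/negP => lt.
exact: nx (lower_central_le lt hj).
Qed.

Section Quotient.
Variable k : nat.
Local Notation pi := (\pi_(quotient_group (@lower_central F k))).

Lemma lower_central_pi1 x : pi x = 1 <-> lower_central k x.
Proof.
split=> [/esym/quotient_groupP/lower_central_normal|h].
  by rewrite invg1 mul1g.
by apply/esym/quotient_groupP/nc_in; rewrite invg1 mul1g.
Qed.

End Quotient.

Local Notation pi k := (\pi_(quotient_group (@lower_central F k))).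

(* Gamma_k / Gamma_(k+1) is abelian, generated by the y_p; the phi_p are the
   dual coordinates. *)
Lemma lower_central_kernel k (I : finType) (y : I -> F) (phi : I -> F -> rat) :
    (0 < k)%N ->
    (forall p, lower_central k (y p)) ->
    (forall x, lower_central k x -> 
      subgroup_gen (range (fun p => pi k.+1 (y p))) (pi k.+1 x)) ->
    (forall p x z, lower_central k x -> lower_central k z ->
      phi p (x * z) = (phi p x + phi p z)%R) ->
    (forall p x, lower_central k.+1 x -> phi p x = 0%R) ->
    (forall p q, phi p (y q) = (p == q)%:R%R) ->
  forall x, lower_central k x -> (forall p, phi p x = 0%R) ->
  lower_central k.+1 x.
Proof.
move=> k0 hy gen phiM phi0 phiy x hx phix.
have yC p q : commute (pi k.+1 (y p)) (pi k.+1 (y q)).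
  apply/commgP/eqP; rewrite -quotient_piR.
  exact/lower_central_pi1/lower_central_commg.
have [m1 [m2 e]] := commuting_span yC (gen _ hx).
pose P (m : I -> nat) := \big[*%g/1]_p (y p) ^+ m p.
have piX z j : pi k.+1 (z ^+ j) = pi k.+1 z ^+ j.
  elim: j => [|j ih]; first exact: quotient_pi1.
  by rewrite !expgS quotient_group_piM ih.
have piP m : pi k.+1 (P m) = \big[*%g/1]_p (pi k.+1 (y p)) ^+ m p.
  rewrite (big_morph _ (@quotient_group_piM _ _) (quotient_pi1 _)).
  by apply: eq_bigr => p _; exact: piX.
have yX p j : lower_central k (y p ^+ j).
  elim: j => [|j ih]; first exact: lower_central1.
  by rewrite expgS; exact: lower_centralM.
have hP m : lower_central k (P m).
  apply: big_ind => [|u v|p _]; [exact: lower_central1| |exact: yX].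
  exact: lower_centralM.
have phi1 p : phi p 1 = 0%R by apply: phi0; exact: lower_central1.
have phiX p q j : phi p (y q ^+ j) = (j * (p == q))%:R%R.
  elim: j => [|j ih]; first by rewrite phi1.
  by rewrite expgS phiM // ih phiy -natrD mulSn.
have phiP p m : phi p (P m) = (m p)%:R%R.
  have [_ ->] : lower_central k (P m) /\
      phi p (P m) = (\sum_q phi p (y q ^+ m q)%g)%R.
    rewrite /P; elim/big_rec2: _ => [|q _ u _ [hu <-]].
      by split; [exact: lower_central1|exact: phi1].
    by split; [exact: lower_centralM|exact: phiM].
  rewrite (bigD1 p) //= phiX eqxx muln1 big1 ?addr0 // => q /negPf.
  by rewrite eq_sym phiX => ->; rewrite muln0.
have hx' : lower_central k.+1 (x^-1 * (P m1 * (P m2)^-1)).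
  apply/lower_central_normal/quotient_groupP.
  by rewrite quotient_group_piM quotient_piV !piP.
(* Evaluating [phi p] on the element of [hx'] gives m1 p - m2 p = [phi p x] = 0, so the two exponent
   vectors agree. *)
suff em : m1 = m2 by apply/lower_central_pi1; rewrite [LHS]e em mulgV.
apply/funext => p; apply/eqP; rewrite -(eqr_nat rat); apply/eqP.
have /esym := phi0 p _ hx'; rewrite phiM; last by
  apply: lower_centralM => //; exact: lower_centralV.
have phiV u : lower_central k u -> phi p u^-1 = (- phi p u)%R.
  move=> hu; have := phiM p u u^-1 hu (lower_centralV hu).
  by rewrite mulgV phi1; lra.
- by rewrite phiM ?phiV // ?phiP ?phix ?phiP; [lra|exact: lower_centralV].
- exact: lower_centralV.
Qed.

End LowerCentral.

(** * Detecting Gamma_2 and Gamma_3 of a free group *)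

Section FreeLowerCentral.
Variable n : nat.
Local Notation F := (free_group n).
Implicit Types (f g : 'I_n -> rat) (x y : F).

Definition delta (i j : 'I_n) : rat := (i == j)%:R.

Lemma fsum_lower_central2 f x : lower_central 2 x -> fsum f x = 0.
Proof.
elim=> {x} [|_ [x [y [_ ->]]]|x y _ hx _ hy|x _ hx].
- exact: fsum1.
- exact: fsum_commg.
- by rewrite fsumM hx hy addr0.
- by rewrite fsumV hx oppr0.
Qed.

Lemma magnus_lower_central3 f g x : lower_central 3 x -> magnus f g x = 0.
Proof.
move=> h; suff [] : lower_central 2 x /\ magnus f g x = 0 by [].
elim: h => {x} [|_ [x [y [hx ->]]]|x y _ [x2 hx] _ [y2 hy]|x _ [x2 hx]].
- by split; [exact: lower_central1|exact: magnus1].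
- split; first exact: lower_central_commg.
  by rewrite magnus_commg !(fsum_lower_central2 _ hx) mul0r mulr0 subrr.
- split; first exact: lower_centralM.
  by rewrite magnusM hx hy (fsum_lower_central2 _ x2) mul0r !addr0.
- split; first exact: lower_centralV.
  by rewrite magnusV hx (fsum_lower_central2 _ x2) mul0r oppr0 addr0.
Qed.

(** The case k = 1 of [lower_central_kernel]: the x_i generate F / Gamma_2, and the exponent sums
    are coordinates dual to them. *)
Lemma fsum_eq0_lower_central2 x :
  (forall i, fsum (delta i) x = 0) -> lower_central 2 x.
Proof.
move=> h; apply: (@lower_central_kernel F 1 _ (@free_gen n)
  (fun i x => fsum (delta i) x)) => //.
- move=> y _; elim/free_group_ind: y => [|i|i|y z hy hz].
  + by rewrite quotient_pi1; exact: sg_1.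
  + by apply: sg_in; exists i.
  + by rewrite quotient_piV; apply/sg_V/sg_in; exists i.
  + by rewrite quotient_group_piM; exact: sg_M.
- by move=> i y z _ _; rewrite fsumM.
- by move=> i y; exact: fsum_lower_central2.
- by move=> i j; rewrite fsum_gen.
Qed.

Section Degree2.
Local Notation pi := (\pi_(quotient_group (@lower_central F 3))).
Local Open Scope group_scope.

Lemma commg_pi_central x y z : [~ pi x, pi y] ^ (pi z) = [~ pi x, pi y].
Proof.
apply/conjg_fixP/eqP; rewrite -!quotient_piR; apply/lower_central_pi1.
do 2!apply: lower_central_commg => //.
Qed.

(** In any group [xy, z] = [x, z]^y [y, z]; the conjugation disappears because commutators are
    central modulo Gamma_3. *)
Lemma commg_pi_Ml x y z : [~ pi (x * y), pi z] = [~ pi x, pi z] * [~ pi y, pi z].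
Proof.
rewrite -[in RHS](commg_pi_central x z y) !quotient_group_piM.
by rewrite !commgEl /conjg !invgM !mulgA !mulgK.
Qed.

Definition upper_pair := {p : 'I_n * 'I_n | (p.1 < p.2)%N}.

(** The case k = 2 of [lower_central_kernel], with the commutators [x_i, x_j], i < j, as generators
    of Gamma_2 / Gamma_3. They generate because the commutator is bilinear modulo Gamma_3. *)
Lemma magnus_eq0_lower_central3 x : lower_central 2 x ->
  (forall i j, magnus (delta i) (delta j) x = 0%R) -> lower_central 3 x.
Proof.
move=> hx h; pose y (p : upper_pair) : F :=
  [~ free_gen (val p).1, free_gen (val p).2].
apply: (@lower_central_kernel F 2 _ y
  (fun p x => magnus (delta (val p).1) (delta (val p).2) x)) => //.
- by move=> p; exact: lower_central_commg.
- set SG := subgroup_gen _ => z.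
  have SG1 : SG 1 by exact: sg_1.
  have commg1 w : [~ pi 1, pi w] = 1.
    by rewrite quotient_pi1 comm1g.
  have commgV u w : [~ pi u^-1, pi w] = [~ pi u, pi w]^-1.
    by apply: (mulgI [~ pi u, pi w]); rewrite -commg_pi_Ml !mulgV commg1.
  have genP i j : SG [~ pi (free_gen i), pi (free_gen j)].
    have key (a b : 'I_n) : (a < b)%N -> SG [~ pi (free_gen a), pi (free_gen b)].
      by move=> ab; apply: sg_in; exists (exist _ (a, b) ab); rewrite // quotient_piR.
    case: (ltngtP i j) => [/key //|/key hji|/val_inj ->].
    - by rewrite -invgR; exact: sg_V.
    - by rewrite commgg.
  have genl i w : SG [~ pi w, pi (free_gen i)].
    elim/free_group_ind: w => [|j|j|u v hu hv].
    + by rewrite commg1.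
    + exact: genP.
    + by rewrite commgV; exact/sg_V/genP.
    + by rewrite commg_pi_Ml; exact: sg_M.
  have allP u w : SG [~ pi u, pi w].
    (* Multiplicativity is known in the first argument; inverting the commutator exchanges the
       two. *)
    rewrite -invgR; apply: sg_V.
    elim/free_group_ind: w => [|j|j|a b ha hb].
    + by rewrite commg1.
    + by rewrite -invgR; exact/sg_V/genl.
    + by rewrite commgV -invgR invgK; exact/genl.
    + by rewrite commg_pi_Ml; exact: sg_M.
  elim=> {z} [|_ [u [v [_ ->]]]|u v _ hu _ hv|u _ hu].
  + by rewrite quotient_pi1.
  + by rewrite quotient_piR.
  + by rewrite quotient_group_piM; exact: sg_M.
  + by rewrite quotient_piV; exact: sg_V.
- move=> p u v hu hv.
  by rewrite magnusM (fsum_lower_central2 _ hu) mul0r addr0.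
- by move=> p u; exact: magnus_lower_central3.
move=> [[i j] /= ij] [[k l] /= kl]; rewrite magnus_commg !fsum_gen /delta.
rewrite -!natrM !mulnb.
have -> : (exist _ (i, j) ij == exist _ (k, l) kl :> upper_pair) =
  (i == k) && (j == l) by [].
(* The second term of the commutator formula would need i = l and j = k, which is incompatible with
   i < j and k < l. *)
suff -> : (i == l) && (j == k) = false by rewrite subr0.
apply/negbTE/negP => /andP [/eqP e1 /eqP e2]; subst.
by have := ltn_trans ij kl; rewrite ltnn.
Qed.
End Degree2.
End FreeLowerCentral.

(** * Evaluating cochains on low-degree bar chains *)

Lemma lin_ext_linl (K : choiceType) (V : lmodType rat) (f u v : K -> V) a c :
    (forall k, f k = a *: u k + v k) ->
  lin_ext f c = a *: lin_ext u c + lin_ext v c.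
Proof.
move=> fE; rewrite /lin_ext scaler_sumr -big_split; apply: eq_bigr => k _ /=.
by rewrite fE scalerDr !scalerA mulrC.
Qed.

Lemma lin_extZl (K : choiceType) (V : lmodType rat) (f u : K -> V) a c :
  (forall k, f k = a *: u k) -> lin_ext f c = a *: lin_ext u c.
Proof.
move=> fE; rewrite /lin_ext scaler_sumr; apply: eq_bigr => k _.
by rewrite fE !scalerA mulrC.
Qed.

Lemma zmod_rearrange (V : zmodType) (s t a b c : V) :
  s - a + (t - b) + (b - c + a) = s + t - c.
Proof.
by rewrite [s - a + _]addrACA -opprD [b - c + a]addrAC [a + b]addrC addrA addrNK.
Qed.

Section BarFacts.
Variable G : groupType.

Lemma lin_ext_bar_d2 (h : G -> rat^o) (z : {malg rat[(G * G)%type]}) :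
  lin_ext h (bar_d2 z) =
  lin_ext (fun p => h p.2 - h (p.1 * p.2)%g + h p.1 : rat^o) z.
Proof.
rewrite /bar_d2 linear_lin_ext; apply: eq_bigr => k _; congr (_ *: _).
by rewrite /= linearD linearB /= !lin_extU.
Qed.

Lemma bar_d2U (a b : G) :
  bar_d2 << (a, b) >> = << b >> - << (a * b)%g >> + << a >>.
Proof. exact: lin_extU. Qed.

Lemma eval2_cup (f g : cocycle1 G) (z : cycle2 G) :
  eval2 (cup f g) (\pi_(homology2 G) z) =
  lin_ext (fun p => val f p.1 * val g p.2 : rat^o) (val z).
Proof. exact: eval2_pi. Qed.

Lemma cocycle1M (f : cocycle1 G) x y :
  val f (x * y)%g = val f x + val f y.
Proof. by move/is_cocycle1P: (valP f). Qed.

Lemma cocycle1_1 (f : cocycle1 G) : val f 1%g = 0.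
Proof. by have := cocycle1M f 1%g 1%g; rewrite mulg1; lra. Qed.

Lemma cocycle1V (f : cocycle1 G) x : val f x^-1%g = - val f x.
Proof. by have := cocycle1M f x x^-1%g; rewrite mulgV cocycle1_1; lra. Qed.

Lemma bar_d2_1 : bar_d2 (<< (1%g, 1%g) >> : {malg rat[(G * G)%type]}) = << 1%g >>.
Proof. by rewrite bar_d2U mulg1 subrr add0r. Qed.

(** The boundary of (a, a^-1) contains an unwanted class of 1, which the boundary of (1, 1)
    removes. *)
Lemma bar_d2_inv (a : G) :
  bar_d2 (- << (a, a^-1%g) >> - << (1%g, 1%g) >>) = - << a^-1%g >> - << a >>.
Proof.
rewrite linearB linearN /= bar_d2U bar_d2_1 mulgV !opprD opprK.
by rewrite [_ - << 1%g >>]addrAC addrK.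
Qed.

Lemma cup_chain_inv (f g : cocycle1 G) (a : G) :
  lin_ext (fun p => val f p.1 * val g p.2 : rat^o)
    (- << (a, a^-1%g) >> - << (1%g, 1%g) >>) = val f a * val g a.
Proof.
by rewrite linearB linearN /= !lin_extU /= cocycle1V cocycle1_1 mulrN opprK
  mul0r subr0.
Qed.

End BarFacts.

(** * Cup products on the 2-cycles of a one-relator group *)

Section OneRelator.
Variables (n : nat) (r : free_group n).
Local Notation F := (free_group n).
Local Notation G := (one_relator_group r).
Local Notation pi := (\pi_(quotient_group (fun x : F => x = r)) : F -> G).

Lemma pi_relator : pi r = 1%g.
Proof. by apply/esym/quotient_groupP/nc_in; rewrite invg1 mul1g. Qed.

(** Write x as a product of conjugates of r and r^-1 and let e be the sum of the signs. When f and g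
    kill r, the correction terms in [magnusM] cancel. The number e comes before f and g, so it
    serves all of them at once. *)
Lemma relator_exponent x : normal_closure (fun x => x = r) x ->
  exists e : rat, (forall f, fsum f x = e * fsum f r) /\
    (forall f g, fsum f r = 0 -> fsum g r = 0 ->
       magnus f g x = e * magnus f g r).
Proof.
elim=> {x} [|x ->|x y _ [a [sa ma]] _ [b [sb mb]]|x _ [a [sa ma]]|x y _ [a [sa ma]]].
- by exists 0; split=> *; rewrite ?fsum1 ?magnus1 mul0r.
- by exists 1; split=> *; rewrite mul1r.
- exists (a + b); split=> [f|f g f0 g0]; first by rewrite fsumM sa sb; ring.
  by rewrite magnusM ma // mb // sa f0; ring.
- exists (- a); split=> [f|f g f0 g0]; first by rewrite fsumV sa; ring.
  by rewrite magnusV ma // sa f0; ring.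
- exists a; split=> [f|f g f0 g0]; first by rewrite /conjg !fsumM fsumV sa; ring.
  by rewrite /conjg !magnusM !fsumM magnusV fsumV ma // !sa f0 g0; ring.
Qed.

Definition gen_values (f : cocycle1 G) (i : 'I_n) : rat :=
  val f (pi (free_gen i)).

Lemma val_cocycle1 (f : cocycle1 G) x : val f (pi x) = fsum (gen_values f) x.
Proof.
apply: (fsum_hom (psi := fun x => val f (pi x))) => // u v.
by rewrite quotient_group_piM cocycle1M.
Qed.

Lemma fsum_gen_values (f : cocycle1 G) : fsum (gen_values f) r = 0.
Proof.
by rewrite -val_cocycle1 pi_relator cocycle1_1.
Qed.

(* For a section s of F -> G, the element s(ab)^-1 s(a) s(b) is a product of
   conjugates of r^{+-1}; its exponent sum e(a, b) does not depend on f, g. *)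
Lemma cycle2_magnus (z : cycle2 G) : exists lam : rat,
  (forall f, lam * fsum f r = 0) /\
  (forall f g : cocycle1 G, eval2 (cup f g) (\pi_(homology2 G) z) =
     lam * magnus (gen_values f) (gen_values g) r).
Proof.
pose s (a : G) : F := repr a.
have sK a : pi (s a) = a by exact: reprK.
have [rho rhoP sM] : exists2 rho : G * G -> F,
    forall p, normal_closure (fun x => x = r) (rho p) &
    forall a b, (s a * s b = s (a * b) * rho (a, b))%g.
  exists (fun p => ((s (p.1 * p.2))^-1 * (s p.1 * s p.2))%g) => [p|a b].
    by apply/quotient_groupP; rewrite quotient_group_piM !sK.
  by rewrite mulVKg.
have [e eP] := choice (fun p => relator_exponent (rhoP p)).
have d2z (h : G -> rat^o) : lin_ext h (bar_d2 (val z)) = 0.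
  by rewrite (eqP (valP z)) linear0.
exists (lin_ext (e : G * G -> rat^o) (val z)); split=> [f|f g].
  (* By [sM] the cochain sending a to [fsum f (s a)] has coboundary e(a, b) * [fsum f r], and
     coboundaries vanish on cycles. *)
  rewrite -[RHS](d2z (fun a => fsum f (s a))) lin_ext_bar_d2 mulrC.
  symmetry; apply: (@lin_extZl _ rat^o _ (e : _ -> rat^o)) => -[a b] /=.
  have := congr1 (fsum f) (sM a b).
  by rewrite !fsumM (eP _).1 /GRing.scale /=; lra.
have sE (k : cocycle1 G) a : val k a = fsum (gen_values k) (s a).
  by rewrite -val_cocycle1 sK.
have f0 := fsum_gen_values f; have g0 := fsum_gen_values g.
set m := magnus _ _ r; pose h a := magnus (gen_values f) (gen_values g) (s a).
(* Taking Magnus coefficients in [sM] gives f(a) g(b) = m e(a, b) - (h(b) - h(ab) + h(a)), and the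
   coboundary of h vanishes on z. *)
rewrite eval2_cup (@lin_ext_linl _ _ _
  (fun p => h p.2 - h (p.1 * p.2)%g + h p.1 : rat^o)
  (fun p => m *: (e p : rat^o)) (-1)); last first.
  move=> [a b] /=; have := congr1 (magnus (gen_values f) (gen_values g)) (sM a b).
  rewrite !sE !magnusM (eP _).2 //.
  by rewrite (eP _).1 g0 /GRing.scale /= /h -/m; lra.
rewrite -lin_ext_bar_d2 d2z scaler0 add0r mulrC.
by apply: (@lin_extZl _ rat^o _ (e : _ -> rat^o)).
Qed.

(** Cutting x into letters, one bar cell per multiplication, gives a chain that compares the class
    of x with the sum of its letters. For x = r in [F, F] it nearly closes up into a cycle. *)
Lemma word_chain x : exists c : {malg rat[(G * G)%type]},
  bar_d2 c = \sum_i fsum (delta i) x *: << pi (free_gen i) >> - << pi x >> /\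
  (forall f g : cocycle1 G, lin_ext (fun p => val f p.1 * val g p.2 : rat^o) c =
    magnus (gen_values f) (gen_values g) x).
Proof.
have sum_gen i : \sum_j fsum (delta j) (free_gen i) *: << pi (free_gen j) >> =
    << pi (free_gen i) >> :> {malg rat[G]}.
  rewrite (bigD1 i) //= fsum_gen /delta eqxx scale1r big1 ?addr0 // => j ji.
  by rewrite fsum_gen /delta (negPf ji) scale0r.
elim/free_group_ind: x => [|i|i|x y [c [dc mc]] [d [dd md]]].
- exists (- << (1%g, 1%g) >>); split=> [|f g].
    rewrite linearN /= bar_d2_1 quotient_pi1 big1 => [|i _]; last by rewrite fsum1 scale0r.
    by rewrite add0r.
  by rewrite magnus1 linearN /= lin_extU cocycle1_1 mul0r oppr0.
- exists 0; split=> [|f g]; first by rewrite sum_gen subrr linear0.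
  by rewrite magnus_gen linear0.
- set a := pi (free_gen i); exists (- << (a, a^-1%g) >> - << (1%g, 1%g) >>).
  split=> [|f g].
    rewrite bar_d2_inv quotient_piV.
    under eq_bigr do rewrite fsumV scaleNr.
    rewrite sumrN.
    rewrite sum_gen.
    exact: addrC.
  by rewrite cup_chain_inv magnusV magnus_gen oppr0 add0r !val_cocycle1.
(* The new cell contributes f(x) g(y), the correction term in [magnusM]. *)
- exists (c + d + << (pi x, pi y) >>); split=> [|f g].
    rewrite !linearD /= dc dd bar_d2U quotient_group_piM.
    under [in RHS]eq_bigr do rewrite fsumM scalerDl.
    rewrite big_split; exact: zmod_rearrange.
  by rewrite !linearD /= lin_extU mc md magnusM !val_cocycle1.
Qed.

(** The exponent sums of r vanish and r becomes 1 in G, so the chain of [word_chain] has boundary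
    minus the class of 1. The cell (1, 1) closes it without changing cup products, as cocycles
    vanish at 1. *)
Lemma relator_cycle : lower_central 2 r -> exists z : cycle2 G,
  forall f g : cocycle1 G, eval2 (cup f g) (\pi_(homology2 G) z) =
    magnus (gen_values f) (gen_values g) r.
Proof.
move=> r2; have [c [dc mc]] := word_chain r.
have z0 : is_cycle2 (c + << (1%g, 1%g) >>).
  rewrite /is_cycle2 linearD /= dc big1 => [|i _]; last first.
    by rewrite (fsum_lower_central2 _ r2) scale0r.
  by rewrite bar_d2_1 add0r pi_relator addNr.
exists (exist (fun z => is_true (is_cycle2 z)) _ z0 : cycle2 _) => f g.
rewrite eval2_cup /= linearD /= mc lin_extU /=.
by rewrite cocycle1_1 mul0r addr0.
Qed.

End OneRelator.

Lemma malgZU (K : choiceType) (a : rat) (k : K) :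
  a *: << k >> = << a *g k >> :> {malg rat[K]}.
Proof. by apply/malgP => l; rewrite mcoeffZ !mcoeffU mulrnAr mulr1. Qed.

(** * The exterior square and the dual of the cup product *)

Section Ext2Theory.
Variable V : lmodType rat.

Lemma ext2_ind (P : ext2 V -> Prop) :
  P 0 -> (forall a x y, P x -> P y -> P (a *: x + y)) ->
  (forall v w, P (wedge v w)) -> forall x, P x.
Proof.
move=> P0 PL Pw; elim/quotW => c; rewrite [c]monalgE.
elim/big_rec: _ => [|[v w] d _ ih].
  by rewrite -[\pi_(ext2 V) 0]/(0 : ext2 V).
by rewrite -malgZU linearP; apply: PL => //; exact: Pw.
Qed.

Lemma ext2_to_lie_linear : linear (@ext2_to_lie V).
Proof.
apply: ext2_lift_linear => [a u v w|a u v w|v].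
- by rewrite lie_gen_linear lie_brPl.
- by rewrite lie_gen_linear lie_brPr.
- exact: lie_brxx.
Qed.

Lemma wedge_linl a (u v w : V) : wedge (a *: u + v) w = a *: wedge u w + wedge v w.
Proof.
rewrite /wedge -linearP; apply/quotmodP/lspan_in; exact: ext2_linl.
Qed.
Lemma wedge_linr a (u v w : V) : wedge w (a *: u + v) = a *: wedge w u + wedge w v.
Proof.
rewrite /wedge -linearP; apply/quotmodP/lspan_in; exact: ext2_linr.
Qed.
Lemma wedge_alt (v : V) : wedge v v = 0.
Proof. by apply/quotmodP/lspan_in; rewrite subr0; exact: ext2_alt. Qed.

End Ext2Theory.

Section Pairing.
Variable G : groupType.
Implicit Types (f g : cohomology1 G) (x : ext2 (homology1 G)).

Definition wedge_eval f g (v w : homology1 G) : rat^o :=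
  eval1 f v * eval1 g w - eval1 f w * eval1 g v.

Let evall f g a u v w :
  wedge_eval f g (a *: u + v) w = a *: wedge_eval f g u w + wedge_eval f g v w.
Proof. by rewrite /wedge_eval !eval1_linr /GRing.scale /=; ring. Qed.
Let evalr f g a u v w :
  wedge_eval f g w (a *: u + v) = a *: wedge_eval f g w u + wedge_eval f g w v.
Proof. by rewrite /wedge_eval !eval1_linr /GRing.scale /=; ring. Qed.

Let liftl a f g h x : ext2_lift (wedge_eval (a *: f + g) h) x =
  a *: ext2_lift (wedge_eval f h) x + ext2_lift (wedge_eval g h) x.
Proof.
apply: lin_ext_linl => k; rewrite /wedge_eval !eval1_linl /GRing.scale /=; ring.
Qed.
Let liftr a f g h x : ext2_lift (wedge_eval h (a *: f + g)) x =
  a *: ext2_lift (wedge_eval h f) x + ext2_lift (wedge_eval h g) x.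
Proof.
apply: lin_ext_linl => k; rewrite /wedge_eval !eval1_linl /GRing.scale /=; ring.
Qed.
Let lifta f x : ext2_lift (wedge_eval f f) x = 0.
Proof.
rewrite /ext2_lift /lin_ext big1 // => k _.
by rewrite /wedge_eval [X in _ - X]mulrC subrr scaler0.
Qed.

Lemma ext2_eval_linl x : linear ((ext2_eval (G := G))^~ x : _ -> rat^o).
Proof.
exact: (ext2_lift_linear (fun a u v w => liftl a u v w x)
  (fun a u v w => liftr a u v w x) (fun f => lifta f x)).
Qed.

Lemma ext2_eval_linr f g : linear (ext2_eval (wedge f g) : _ -> rat^o).
Proof.
move=> a x y; rewrite /ext2_eval !(ext2_lift_wedge (fun a u v w => liftl a u v w _)
  (fun a u v w => liftr a u v w _) (fun f => lifta f _)).
exact: (ext2_lift_linear (@evall f g) (@evalr f g) (fun v => subrr _)).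
Qed.

Lemma eval2_linl (z : homology2 G) : linear ((eval2 (G := G))^~ z : _ -> rat^o).
Proof.
elim/quotW: z => z a; elim/quotW => f; elim/quotW => g.
rewrite -linearP !eval2_pi; apply: lin_ext_linl => k.
have -> : val (a *: f + g) = a *: val f + val g by exact: linearP.
by rewrite !addrfctE !scalrfctE.
Qed.

Lemma cup_product_map_linear : linear (@cup_product_map G).
Proof.
apply: ext2_lift_linear; [exact: cup_linl|exact: cup_linr|exact: cup_alt].
Qed.

Lemma eval2_cup_linl (z : homology2 G) a f g h :
  eval2 (cup (a *: f + g) h) z = a * eval2 (cup f h) z + eval2 (cup g h) z.
Proof. by rewrite cup_linl eval2_linl. Qed.
Lemma eval2_cup_linr (z : homology2 G) a f g h :
  eval2 (cup h (a *: f + g)) z = a * eval2 (cup h f) z + eval2 (cup h g) z.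
Proof. by rewrite cup_linr eval2_linl. Qed.

Lemma eval2_0 (z : homology2 G) : eval2 0 z = 0.
Proof.
by have := eval2_linl z 1 0 0; rewrite /= scaler0 addr0 /GRing.scale /=; lra.
Qed.

Lemma eval2_cupC (z : homology2 G) f g :
  eval2 (cup g f) z = - eval2 (cup f g) z.
Proof.
have := cup_alt (1 *: f + g); rewrite cup_linl !cup_linr !cup_alt.
rewrite scaler0 add0r addr0 !scale1r => /(congr1 ((eval2 (G := G))^~ z)).
rewrite /= eval2_0 -[cup f g]scale1r eval2_linl !scale1r; lra.
Qed.

End Pairing.

Lemma linear_at0 (V W : lmodType rat) (f : V -> W) : linear f -> f 0 = 0.
Proof. by move=> /(_ (-1) 0 0); rewrite scaler0 addr0 scaleN1r addNr. Qed.

Lemma linear_scale_sum (V W : lmodType rat) (f : V -> W) (I : finType)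
    (a : I -> rat) (u : I -> V) :
  linear f -> f (\sum_i a i *: u i) = \sum_i a i *: f (u i).
Proof.
move=> fl; have f0 := linear_at0 fl.
by elim/big_rec2: _ => [//|i x y _ <-]; rewrite fl.
Qed.

Lemma scale_lin (V : lmodType rat) (a b c d : rat) (w : V) :
  d = a * b + c -> a *: (b *: w) + c *: w = d *: w.
Proof. by move=> ->; rewrite scalerA scalerDl. Qed.

Section Alternating.
Variables (V W : lmodType rat) (f : V -> V -> W).
Hypothesis fl : forall a u v w, f (a *: u + v) w = a *: f u w + f v w.
Hypothesis fr : forall a u v w, f w (a *: u + v) = a *: f w u + f w v.
Hypothesis fa : forall v, f v v = 0.

Lemma alternating_skew u v : f v u = - f u v.
Proof.
have := fa (1 *: u + v); rewrite fl !fr !fa scaler0 add0r addr0 !scale1r => /eqP.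
by rewrite addrC addr_eq0 => /eqP.
Qed.

Lemma bilinear_expand (I : finType) (e : I -> V) (a b : I -> rat) :
  f (\sum_i a i *: e i) (\sum_i b i *: e i) =
  \sum_i \sum_j (a i * b j) *: f (e i) (e j).
Proof.
rewrite (@linear_scale_sum _ _ (fun u => f u _)); last by move=> c x y; exact: fl.
apply: eq_bigr => i _; rewrite linear_scale_sum; last by move=> c x y; exact: fr.
by rewrite scaler_sumr; apply: eq_bigr => j _; rewrite scalerA.
Qed.

(** Average f u v with - f v u. The sum over all ordered pairs counts each unordered pair twice,
    whence the half. *)
Lemma alternating_expand (I : finType) (e : I -> V) (a b : I -> rat) :
  f (\sum_i a i *: e i) (\sum_i b i *: e i) =
  \sum_i \sum_j ((a i * b j - b i * a j) / 2) *: f (e i) (e j).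
Proof.
set u := \sum_i a i *: e i; set v := \sum_i b i *: e i.
have -> : f u v = 2^-1 *: f u v - 2^-1 *: f v u.
  rewrite (alternating_skew u v) scalerN opprK -scalerDl -[LHS]scale1r.
  by congr (_ *: _); field.
rewrite /u /v !bilinear_expand !scaler_sumr -sumrB; apply: eq_bigr => i _.
rewrite !scaler_sumr -sumrB; apply: eq_bigr => j _.
by rewrite !scalerA -scalerBl; congr (_ *: _); ring.
Qed.

End Alternating.

(** For skew c this is the sum over i < j of c_ij [e_i, e_j]; in an associative algebra it becomes
    the sum over all i, j of c_ij e_i e_j. *)
Definition quadratic_relator (V : lmodType rat) m (e : 'I_m -> V)
    (c : 'I_m -> 'I_m -> rat) : free_lie V :=
  \sum_i \sum_j (c i j / 2) *: lie_br (lie_gen (e i)) (lie_gen (e j)).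

Section DualBasis.
Variables (G : groupType) (m : nat).
Variables (e : 'I_m -> homology1 G) (chi : 'I_m -> cohomology1 G).
Hypothesis span : forall v, v = \sum_i eval1 (chi i) v *: e i.

Lemma ext2_expand x : x = \sum_i \sum_j
  (ext2_eval (wedge (chi i) (chi j)) x / 2) *: wedge (e i) (e j).
Proof.
elim/ext2_ind: x => [|a x y hx hy|v w].
- rewrite big1 // => i _; rewrite big1 // => j _.
  by rewrite (linear_at0 (ext2_eval_linr (chi i) (chi j))) mul0r scale0r.
- rewrite {1}hx {1}hy scaler_sumr -big_split; apply: eq_bigr => i _ /=.
  rewrite scaler_sumr -big_split; apply: eq_bigr => j _ /=.
  apply: scale_lin; rewrite -[X in X / 2]/(_ : rat^o) ext2_eval_linr.
  by rewrite mulrDl -mulrA.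
- rewrite {1}[v]span {1}[w]span (alternating_expand (@wedge_linl _) (@wedge_linr _)
    (@wedge_alt _)).
  apply: eq_bigr => i _; apply: eq_bigr => j _.
  by rewrite ext2_eval_wedge.
Qed.

Lemma ext2_to_lie_expand x :
  ext2_to_lie x = quadratic_relator e (fun i j => ext2_eval (wedge (chi i) (chi j)) x).
Proof.
rewrite [x in LHS]ext2_expand.
pose L := @ext2_to_lie_linear (homology1 G).
have L0 := linear_at0 L.
have LD u v : ext2_to_lie (u + v) =
    ext2_to_lie u + ext2_to_lie v :> free_lie (homology1 G).
  by have := L 1 u v; rewrite !scale1r.
rewrite (big_morph _ LD L0); apply: eq_bigr => i _.
by rewrite (linear_scale_sum _ _ L); apply: eq_bigr => j _; rewrite ext2_to_lie_wedge.
Qed.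

Lemma cohomology1_expand f : f = \sum_i eval1 f (e i) *: chi i.
Proof.
apply/val_inj/funext => x.
have evx (g : cohomology1 G) : eval1 g (\pi_(homology1 G) << x >>) = val g x.
  by rewrite eval1_pi lin_extU.
rewrite -!evx; set v := \pi_(homology1 G) _.
rewrite (@linear_scale_sum _ rat^o (fun g => eval1 g v)); last first.
  by move=> a g h; exact: eval1_linl.
rewrite {1}[v]span (@linear_scale_sum _ rat^o (eval1 f)); last first.
  exact: eval1_linr.
by apply: eq_bigr => i _; rewrite /GRing.scale /= mulrC.
Qed.

(** The defining relators of [holonomy] can thus be read off from the cup products of a dual
    basis. *)
Lemma dual_cup_lie x (z : homology2 G) :
    (forall w, ext2_eval w x = eval2 (cup_product_map w) z) ->
  ext2_to_lie x = quadratic_relator e (fun i j => eval2 (cup (chi i) (chi j)) z).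
Proof.
move=> hz; rewrite ext2_to_lie_expand; apply: eq_bigr => i _.
by apply: eq_bigr => j _; rewrite hz cup_product_map_wedge.
Qed.

(** [im_dual_cup] is defined by adjunction, so the existence of an adjoint element has to be shown.
    It is the sum of B_ij / 2 times e_i /\ e_j, where B_ij is the value of chi_i cup chi_j on z. *)
Lemma dual_cup_exists (z : homology2 G) :
  exists x, forall w, ext2_eval w x = eval2 (cup_product_map w) z.
Proof.
pose B f g : rat^o := eval2 (cup f g) z.
pose u i := \sum_j (B (chi i) (chi j) / 2) *: wedge (e i) (e j).
(* The coefficient 1 gives the sum the shape that [linear_scale_sum] rewrites. *)
exists (\sum_i 1 *: u i).
have key f g : ext2_eval (wedge f g) (\sum_i 1 *: u i) = eval2 (cup f g) z.
  rewrite (linear_scale_sum _ _ (ext2_eval_linr f g)) -[RHS]/(B f g).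
  rewrite [f in RHS]cohomology1_expand [g in RHS]cohomology1_expand.
  rewrite (@alternating_expand _ _ B); last first.
  - by move=> h; rewrite /B cup_alt eval2_0.
  - by move=> a v w h; exact: eval2_cup_linr.
  - by move=> a v w h; exact: eval2_cup_linl.
  apply: eq_bigr => i _; rewrite scale1r.
  rewrite /u (linear_scale_sum _ _ (ext2_eval_linr f g)); apply: eq_bigr => j _.
  by rewrite ext2_eval_wedge /GRing.scale /=; ring.
elim/ext2_ind => [|a v w hv hw|f g].
- rewrite (linear_at0 (@ext2_eval_linl G _)) (linear_at0 (@cup_product_map_linear G)).
  by rewrite eval2_0.
- by rewrite ext2_eval_linl cup_product_map_linear eval2_linl hv hw.
- by rewrite key cup_product_map_wedge.
Qed.

End DualBasis.

(** The Jacobi identity for commutators of operators: the six variables are the products of three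
    operators in all orders. *)
Lemma zmod_jacobi (V : zmodType) (a b c d e f : V) :
  a - b - (c - d) + (c - e - (f - b)) + (f - d - (a - e)) = 0.
Proof.
have E (u v w x : V) : u - v - (w - x) = u + x - (v + w).
  by rewrite opprB addrACA -opprD.
rewrite !E [c + b]addrC [f + e]addrC [d + a]addrC.
by rewrite !subrKA subrr.
Qed.

(** * Representations of free Lie algebras, their quotients and envelopes *)

Section FreeLieRepresentation.
Variables (V M : lmodType rat) (act : V -> M -> M).
Hypothesis act_linl : forall a u v m, act (a *: u + v) m = a *: act u m + act v m.
Hypothesis act_linr : forall v, linear (act v).

Fixpoint lie_term_act (s : lie_term V) (m : M) : M :=
  match s with
  | LieGen v => act v m
  | LieZero => 0
  | LieAdd s t => lie_term_act s m + lie_term_act t m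
  | LieScale a s => a *: lie_term_act s m
  | LieBr s t =>
      lie_term_act s (lie_term_act t m) - lie_term_act t (lie_term_act s m)
  end.

Lemma lie_term_act_linear s : linear (lie_term_act s).
Proof.
elim: s => [v||s ihs t iht|b s ihs|s ihs t iht] a m m' /=.
- exact: act_linr.
- by rewrite scaler0 addr0.
- by rewrite ihs iht scalerDr addrACA.
- by rewrite ihs scalerDr !scalerA mulrC.
- by rewrite iht ihs iht ihs scalerBr opprD addrACA.
Qed.

Let actB s m m' : lie_term_act s (m - m') = lie_term_act s m - lie_term_act s m'.
Proof.
by rewrite addrC -scaleN1r lie_term_act_linear scaleN1r addrC.
Qed.

Lemma lie_term_act_eq s t : lie_eq s t -> lie_term_act s =1 lie_term_act t.
Proof.
elim=> {s t} /=.
- by [].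
- by move=> s t _ ih m; rewrite ih.
- by move=> s t u _ ih _ ih' m; rewrite ih.
- by move=> s s' t t' _ ih _ ih' m; rewrite ih ih'.
- by move=> a s s' _ ih m; rewrite ih.
- by move=> s s' t t' _ ih _ ih' m; rewrite !ih !ih'.
- by move=> s t u m; rewrite addrA.
- by move=> s t m; rewrite addrC.
- by move=> s m; rewrite add0r.
- by move=> s m; rewrite scaleN1r addNr.
- by move=> a b s m; rewrite scalerA.
- by move=> s m; rewrite scale1r.
- by move=> a s t m; rewrite scalerDr.
- by move=> a b s m; rewrite scalerDl.
- by move=> a s t u m; rewrite lie_term_act_linear scalerBr opprD addrACA.
- by move=> a s t u m; rewrite lie_term_act_linear scalerBr opprD addrACA.
- by move=> s m; rewrite subrr.
- by move=> s t u m; rewrite !actB zmod_jacobi.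
- by move=> a v w m; rewrite act_linl.
Qed.

Definition free_lie_act (x : free_lie V) : M -> M := lie_term_act (repr x).

Let act_pi s : free_lie_act (\pi_(free_lie V) s) =1 lie_term_act s.
Proof. by apply/lie_term_act_eq/free_lieP; rewrite reprK. Qed.

Lemma free_lie_act_gen v m : free_lie_act (lie_gen v) m = act v m.
Proof. exact: act_pi. Qed.

Lemma free_lie_act_linl a x y m :
  free_lie_act (a *: x + y) m = a *: free_lie_act x m + free_lie_act y m.
Proof.
rewrite -[a *: x + y]/(\pi_(free_lie V)
  (LieAdd (repr (\pi_(free_lie V) (LieScale a (repr x)))) (repr y))).
by rewrite act_pi /=; congr (_ + _); exact: (act_pi (LieScale a (repr x))).
Qed.

Lemma free_lie_act_linear x : linear (free_lie_act x).
Proof. exact: lie_term_act_linear. Qed.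

Lemma free_lie_act_br x y m : free_lie_act (lie_br x y) m =
  free_lie_act x (free_lie_act y m) - free_lie_act y (free_lie_act x m).
Proof. by rewrite -[lie_br x y]/(\pi_(free_lie V) (LieBr (repr x) (repr y))) act_pi. Qed.

End FreeLieRepresentation.

Lemma lie_quot_piR (L : lieAlgType) (S : set L) (x y : L) :
  \pi_(lie_quot S) (lie_br x y) =
  lie_br (\pi_(lie_quot S) x : lie_quot S) (\pi_(lie_quot S) y : lie_quot S).
Proof.
have reprP z : lie_ideal S (z - repr (\pi_(lie_quot S) z)).
  by apply/lie_quotP; rewrite reprK.
rewrite -[RHS]/(\pi_(lie_quot S) (lie_br (repr _) (repr _))).
apply/lie_quotP; set x' := repr _; set y' := repr _.
have -> : lie_br x y - lie_br x' y' =
    (-1) *: lie_br y (x - x') + lie_br x' (y - y').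
  by rewrite !lie_brBr scaleN1r opprB (lie_brC x' y) (lie_brC x y) addrACA subrr add0r.
by apply: li_lin; apply: li_br; exact: reprP.
Qed.

Section QuotientRepresentation.
Variables (L : lieAlgType) (S : set L) (M : lmodType rat) (act : L -> M -> M).
Hypothesis act_linl : forall a x y m, act (a *: x + y) m = a *: act x m + act y m.
Hypothesis act_linr : forall x, linear (act x).
Hypothesis act_br : forall x y m,
  act (lie_br x y) m = act x (act y m) - act y (act x m).
Hypothesis act_S : forall x m, S x -> act x m = 0.

(** The elements acting by zero form an ideal. *)
Lemma act_lie_ideal x m : lie_ideal S x -> act x m = 0.
Proof.
move=> h; elim: h m => {x} [|x hx|a x y _ hx _ hy|x y _ hy] m.
- by have := act_linl (-1) 0 0 m; rewrite scaler0 addr0 scaleN1r addNr.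
- exact: act_S.
- by rewrite act_linl hx hy scaler0 addr0.
- by rewrite act_br !hy (linear_at0 (act_linr x)) subrr.
Qed.

Definition lie_quot_act (x : lie_quot S) : M -> M := act (repr x).

Lemma lie_quot_act_pi x m : lie_quot_act (\pi_(lie_quot S) x) m = act x m.
Proof.
have h : lie_ideal S (repr (\pi_(lie_quot S) x) - x).
  by apply/lie_quotP; rewrite reprK.
have := act_linl 1 (repr (\pi_(lie_quot S) x) - x) x m.
by rewrite (act_lie_ideal _ h) scale1r subrK scaler0 add0r.
Qed.

Lemma lie_quot_act_linl a x y m :
  lie_quot_act (a *: x + y) m = a *: lie_quot_act x m + lie_quot_act y m.
Proof.
have -> : a *: x + y = \pi_(lie_quot S) (a *: repr x + repr y).
  by rewrite -{1}[x]reprK -{1}[y]reprK; exact/esym/quotmod_pi_linear.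
by rewrite lie_quot_act_pi act_linl.
Qed.

Lemma lie_quot_act_linear x : linear (lie_quot_act x).
Proof. exact: act_linr. Qed.

Lemma lie_quot_act_br x y m : lie_quot_act (lie_br x y) m =
  lie_quot_act x (lie_quot_act y m) - lie_quot_act y (lie_quot_act x m).
Proof.
rewrite -[lie_br x y]/(\pi_(lie_quot S) (lie_br (repr x) (repr y))).
by rewrite lie_quot_act_pi act_br.
Qed.

End QuotientRepresentation.

Section EnvelopeRepresentation.
Variables (L : lieAlgType) (M : lmodType rat) (act : L -> M -> M).
Hypothesis act_linl : forall a x y m, act (a *: x + y) m = a *: act x m + act y m.
Hypothesis act_linr : forall x, linear (act x).
Hypothesis act_br : forall x y m,
  act (lie_br x y) m = act x (act y m) - act y (act x m).

Fixpoint env_term_act (s : env_term L) (m : M) : M :=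
  match s with
  | EnvGen x => act x m
  | EnvZero => 0
  | EnvOne => m
  | EnvAdd s t => env_term_act s m + env_term_act t m
  | EnvScale a s => a *: env_term_act s m
  | EnvMul s t => env_term_act s (env_term_act t m)
  end.

Lemma env_term_act_linear s : linear (env_term_act s).
Proof.
elim: s => [x|||s ihs t iht|b s ihs|s ihs t iht] a m m' /=.
- exact: act_linr.
- by rewrite scaler0 addr0.
- by [].
- by rewrite ihs iht scalerDr addrACA.
- by rewrite ihs scalerDr !scalerA mulrC.
- by rewrite iht ihs.
Qed.

Lemma env_term_act_eq s t : env_eq s t -> env_term_act s =1 env_term_act t.
Proof.
have actD s' m m' : env_term_act s' (m + m') = env_term_act s' m + env_term_act s' m'.
  by have := env_term_act_linear s' 1 m m'; rewrite !scale1r.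
elim=> {s t} /=.
- by [].
- by move=> s t _ ih m; rewrite ih.
- by move=> s t u _ ih _ ih' m; rewrite ih.
- by move=> s s' t t' _ ih _ ih' m; rewrite ih ih'.
- by move=> a s s' _ ih m; rewrite ih.
- by move=> s s' t t' _ ih _ ih' m; rewrite ih ih'.
- by move=> s t u m; rewrite addrA.
- by move=> s t m; rewrite addrC.
- by move=> s m; rewrite add0r.
- by move=> s m; rewrite scaleN1r addNr.
- by move=> a b s m; rewrite scalerA.
- by move=> s m; rewrite scale1r.
- by move=> a s t m; rewrite scalerDr.
- by move=> a b s m; rewrite scalerDl.
- by [].
- by [].
- by [].
- by [].
- by move=> s t u m; rewrite actD.
- by [].
- move=> a s t m; have := env_term_act_linear s a (env_term_act t m) 0.
  by rewrite (linear_at0 (env_term_act_linear s)) !addr0.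
- by move=> a x y m; rewrite act_linl.
- by move=> x y m; rewrite act_br scaleN1r.
Qed.

Definition envelope_act (u : envelope L) : M -> M := env_term_act (repr u).

Let act_pi s : envelope_act (\pi_(envelope L) s) =1 env_term_act s.
Proof. by apply/env_term_act_eq/envelopeP; rewrite reprK. Qed.

Lemma envelope_act_gen x m : envelope_act (env_gen x) m = act x m.
Proof. exact: act_pi. Qed.

Lemma envelope_act1 m : envelope_act 1 m = m.
Proof. exact: (act_pi (EnvOne L)). Qed.

Lemma envelope_actM u v m :
  envelope_act (u * v) m = envelope_act u (envelope_act v m).
Proof. exact: (act_pi (EnvMul (repr u) (repr v))). Qed.

Lemma envelope_act_linl a u v m :
  envelope_act (a *: u + v) m = a *: envelope_act u m + envelope_act v m.
Proof.
rewrite -[a *: u + v]/(\pi_(envelope L)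
  (EnvAdd (repr (\pi_(envelope L) (EnvScale a (repr u)))) (repr v))).
by rewrite act_pi /=; congr (_ + _); exact: (act_pi (EnvScale a (repr u))).
Qed.

End EnvelopeRepresentation.

Lemma addNr_eq0 (V : zmodType) (x y : V) : x = y -> - x + y = 0.
Proof. by move=> ->; exact: addNr. Qed.

(** * Letters acting on words modulo a quadratic relation *)

Section WordActions.
Variable m : nat.
Local Notation word := (seq 'I_m).
Local Notation M := {malg rat[word]}.
Implicit Types (w : word) (c : 'I_m -> 'I_m -> rat).

Definition word_prod (A : pzRingType) (x : 'I_m -> A) w : A :=
  \prod_(i <- w) x i.

Definition normal_span (nrm : pred word) (k : nat) : set M :=
  lspan (fun v => exists w, [/\ nrm w, size w = k & v = << w >>]).

(* The letters act on Q[words], a model of the free algebra modulo the relation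
   sum_ij c_ij x_i x_j, in which the normal words represent a basis. *)
Record word_action c (act : 'I_m -> word -> M) (nrm : pred word) : Prop := {
  nrm_nil : nrm [::];
  nrm_tail : forall i w, nrm (i :: w) -> nrm w;
  act_nrm : forall i w, nrm (i :: w) -> act i w = << i :: w >>;
  act_span : forall i w, nrm w -> normal_span nrm (size w).+1 (act i w);
  act_relation : forall w,
    \sum_i \sum_j c i j *: lin_ext (act i) (act j w) = 0;
  act_prod : forall (A : algType rat) (x : 'I_m -> A),
    \sum_i \sum_j c i j *: (x i * x j) = 0 ->
    forall i w, lin_ext (word_prod x) (act i w) = x i * word_prod x w }.

Definition free_act (i : 'I_m) w : M := << i :: w >>.

Lemma free_word_action c : (forall i j, c i j = 0) ->
  word_action c free_act xpredT.
Proof.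
move=> c0; split=> //.
- by move=> i w _; apply: lspan_in; exists (i :: w).
- move=> w; rewrite big1 // => i _; rewrite big1 // => j _.
  by rewrite c0 scale0r.
- by move=> A x _ i w; rewrite lin_extU /word_prod big_cons.
Qed.

Section Quadratic.
Variables (c : 'I_m -> 'I_m -> rat) (a b : 'I_m).
Hypotheses (cab : c a b != 0) (caa : c a a = 0).

Let ab : a != b.
Proof. by apply: contraNneq cab => <-; rewrite caa. Qed.

Definition prefix_map (i : 'I_m) : M -> M := lin_ext (fun w => << i :: w >>).

(* The rewriting rule x_a x_b = - c_ab^-1 sum_(ij <> ab) c_ij x_i x_j.  Only x_a,
   acting on a word that starts with b, does more than prepend its letter; as
   a != b, the recursion below is therefore structural. *)
Fixpoint quadratic_act w (j : 'I_m) : M :=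
  match w with
  | [::] => << [:: j] >>
  | i :: w' =>
    if (j == a) && (i == b) then
      - (c a b)^-1 *:
        (\sum_(k | (k != a) && (k != b)) c a k *: << [:: a, k & w'] >> +
         \sum_(i | i != a) \sum_k c i k *: prefix_map i (quadratic_act w' k))
    else << j :: w >>
  end.

Definition avoids_ab w := sorted (fun i j => ~~ ((i == a) && (j == b))) w.

(** Isolates the leading monomial x_a x_b; the rest has the shape used in [quadratic_act]. *)
Let split_relation (T : lmodType rat) (t : 'I_m -> 'I_m -> T) :
  \sum_i \sum_k c i k *: t i k = c a b *: t a b +
    (\sum_(k | (k != a) && (k != b)) c a k *: t a k +
     \sum_(i | i != a) \sum_k c i k *: t i k).
Proof.
rewrite (bigD1 a) //= (bigD1 a) //= caa scale0r add0r.
by rewrite (bigD1 b) 1?eq_sym //= addrA.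
Qed.

Let act_cons j w : ~~ ((j == a) && (ohead w == Some b)) ->
  quadratic_act w j = << j :: w >>.
Proof.
case: w => //= i w; case: (j == a) => //= h.
by rewrite ifN //; apply: contra h => /eqP ->.
Qed.

Let act_ne j w : j != a -> quadratic_act w j = << j :: w >>.
Proof. by move=> ja; apply: act_cons; rewrite (negPf ja). Qed.

Let act_prefix j v : j != a -> lin_ext (quadratic_act^~ j) v = prefix_map j v.
Proof. by move=> ja; apply: eq_bigr => w _; rewrite act_ne. Qed.

Lemma quadratic_word_action :
  word_action c (fun j w => quadratic_act w j) avoids_ab.
Proof.
split=> //.
- by move=> i w /path_sorted.
- move=> i w h; apply: act_cons; case: w h => [|j w] /=; first by rewrite andbF.
  by case/andP.
- move=> i w; elim: w i => [|i w ih] j h /=.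
    by apply: lspan_in; exists [:: j].
  case: ifP => [/andP [_ /eqP ib]|jab]; last first.
    by apply: lspan_in; exists [:: j, i & w]; split=> //=; rewrite jab.
  have {}h : avoids_ab w := path_sorted h.
  have sum_span (P : pred 'I_m) (F : 'I_m -> M) d :
      (forall i, P i -> normal_span avoids_ab d (F i)) ->
      normal_span avoids_ab d (\sum_(i | P i) F i).
    by move=> hF; apply: big_ind => //; [exact: lspan_0|exact: lspanD].
  (* Two kinds of words arise: a k w with k different from a and b, and l u' with l different from
     a, where w and u' are normal. Neither contains ab. *)
  apply: lspanZ; apply: lspanD.
    apply: (sum_span) => k /andP [ka kb]; apply/lspanZ/lspan_in.
    exists [:: a, k & w]; split=> //=; rewrite (negPf kb) andbF /=.
    by case: w h {ih} => //= l w ->; rewrite (negPf ka).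
  apply: (sum_span) => l la; apply: (sum_span) => k _; apply: lspanZ.
  elim: (ih k h) => [|z u v [u' [hu su ->]] _ hv].
    by rewrite /prefix_map linear0; exact: lspan_0.
  rewrite /prefix_map linearP /= lin_extU; apply: lspan_lin hv.
  exists (l :: u'); split=> //=; last by rewrite su.
  by case: u' hu {su} => //= ? ? ->; rewrite (negPf la).
(* x_b prepends b, and x_a then acts on b w by the rewriting rule, whose right side is chosen to
   cancel all other terms. *)
- move=> w; rewrite split_relation.
  rewrite (@act_ne b) 1?eq_sym // lin_extU /= !eqxx /= scalerA mulrN mulfV //.
  rewrite scaleN1r; apply: addNr_eq0; apply: congr2.
    apply: eq_bigr => k /andP [ka kb].
    by rewrite act_ne // lin_extU /= (negPf kb) andbF.
  by apply: eq_bigr => i ia; apply: eq_bigr => k _; rewrite act_prefix.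
- move=> A x hx i w.
  have prefP j v : lin_ext (word_prod x) (prefix_map j v) = x j * lin_ext (word_prod x) v.
    rewrite /prefix_map linear_lin_ext [in RHS]/lin_ext mulr_sumr.
    apply: eq_bigr => u _.
    by rewrite /= lin_extU /word_prod big_cons scalerAr.
  elim: w i => [|i w ih] j /=.
    by rewrite lin_extU /word_prod big_cons.
  case: ifP => [/andP [/eqP -> /eqP ->]|_]; last first.
    by rewrite lin_extU /word_prod big_cons.
  set W := word_prod x w.
  have hxW : \sum_i \sum_k c i k *: (x i * (x k * W)) = 0.
    rewrite -[RHS](mul0r W) -[X in _ = X * W]hx mulr_suml.
    apply: eq_bigr => k _; rewrite mulr_suml; apply: eq_bigr => l _.
    by rewrite -scalerAl mulrA.
  have -> : word_prod x (b :: w) = x b * W by rewrite /word_prod big_cons.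
  rewrite linearZ linearD /= !linear_sum.
  (* The relation in A expresses c_ab x_a x_b W by the remaining terms, which match those of
     [quadratic_act] by induction. *)
  move: hxW; rewrite split_relation => /eqP; rewrite addr_eq0 => /eqP hW.
  apply: (scalerI cab); rewrite hW scalerA mulrN mulfV // scaleN1r.
  apply: congr1; apply: congr2.
    apply: eq_bigr => k _; rewrite linearZ /= lin_extU.
    by rewrite /word_prod !big_cons.
  apply: eq_bigr => l _; rewrite linear_sum; apply: eq_bigr => k _.
  by rewrite linearZ /= prefP ih.
Qed.

End Quadratic.
End WordActions.

Lemma linear_malgE (K : choiceType) (W : lmodType rat) (f : {malg rat[K]} -> W) x :
  linear f -> f x = lin_ext (fun k => f << k >>) x.
Proof.
move=> fl; have D y z : f (y + z) = f y + f z by have := fl 1 y z; rewrite !scale1r.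
have f0 := linear_at0 fl; have Z a y : f (a *: y) = a *: f y.
  by have := fl a y 0; rewrite f0 !addr0.
rewrite {1}[x]monalgE (big_morph f D f0); apply: eq_bigr => k _.
by rewrite -malgZU Z.
Qed.

Lemma lin_ext_eq0 (K : choiceType) (W : lmodType rat) (f : K -> W) x :
  (forall k, f k = 0) -> lin_ext f x = 0.
Proof. by move=> f0; rewrite /lin_ext big1 // => k _; rewrite f0 scaler0. Qed.

Section WordLists.
Variable m : nat.

Fixpoint words (k : nat) : seq (seq 'I_m) :=
  if k is k'.+1 then [seq i :: w | i <- enum 'I_m, w <- words k'] else [:: [::]].

Lemma mem_words k w : (w \in words k) = (size w == k).
Proof.
elim: k w => [|k ih] [|i w] //=.
  by apply/negbTE/negP => /allpairsP [[j u] []].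
apply/allpairsP/idP => [[[j u] [_ /= hu [_ ->]]]|hw].
  by rewrite eqSS -ih.
by exists (i, w); rewrite mem_enum ih.
Qed.

Lemma uniq_words k : uniq (words k).
Proof.
elim: k => //= k ih; apply: allpairs_uniq => //; first exact: enum_uniq.
by move=> [i u] [j v] _ _ /= [-> ->].
Qed.

End WordLists.

(** * Normal monomials form a basis of the enveloping algebra *)

Section EnvelopeBasis.
Variables (V : lmodType rat) (m : nat) (e : 'I_m -> V) (co : 'I_m -> V -> rat).
Hypothesis co_linear : forall i a u v, co i (a *: u + v) = a * co i u + co i v.
Hypothesis span : forall v, v = \sum_i co i v *: e i.
Hypothesis dual : forall i j, co i (e j) = (i == j)%:R.
Variables (c : 'I_m -> 'I_m -> rat) (S : set (free_lie V)).
Hypothesis c_skew : forall i j, c j i = - c i j.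
Hypothesis S_relator : forall x, S x -> exists lam, x = lam *: quadratic_relator e c.
Hypothesis relator_S : lie_ideal S (quadratic_relator e c).
Variables (act : 'I_m -> seq 'I_m -> {malg rat[seq 'I_m]}) (nrm : pred (seq 'I_m)).
Hypothesis actP : word_action c act nrm.

Local Notation M := {malg rat[seq 'I_m]}.
Local Notation L := (lie_quot S).
Local Notation U := (envelope L).

Let vact (v : V) (u : M) : M := \sum_i co i v *: lin_ext (act i) u.

Let vact_linl a u v x : vact (a *: u + v) x = a *: vact u x + vact v x.
Proof.
rewrite /vact scaler_sumr -big_split; apply: eq_bigr => i _.
by rewrite co_linear scalerDl scalerA.
Qed.

Let vact_linr v : linear (vact v).
Proof.
move=> a x y; rewrite /vact scaler_sumr -big_split; apply: eq_bigr => i _.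
by rewrite linearP scalerDr !scalerA mulrC.
Qed.

Let vact_basis i x : vact (e i) x = lin_ext (act i) x.
Proof.
rewrite /vact (bigD1 i) //= dual eqxx scale1r big1 ?addr0 // => j /negPf ji.
by rewrite dual ji scale0r.
Qed.

Local Notation lact := (free_lie_act vact).
Let lact_linl := free_lie_act_linl vact_linl vact_linr.
Let lact_linr := free_lie_act_linear vact_linr.
Let lact_br := free_lie_act_br vact_linl vact_linr.

(** Exchanging i and j in the second terms and using the skewness of c turns them into a copy of the
    first. *)
Let half_commutators (T : lmodType rat) (t : 'I_m -> 'I_m -> T) :
  \sum_i \sum_j (c i j / 2) *: (t i j - t j i) = \sum_i \sum_j c i j *: t i j.
Proof.
transitivity (\sum_i \sum_j (c i j / 2) *: t i j +
              \sum_i \sum_j (c j i / 2) *: t j i).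
  rewrite -big_split; apply: eq_bigr => i _; rewrite -big_split.
  by apply: eq_bigr => j _; rewrite scalerBr -scaleNr -mulNr -c_skew.
rewrite [X in _ + X]exchange_big -big_split; apply: eq_bigr => i _.
rewrite -big_split; apply: eq_bigr => j _ /=; rewrite -scalerDl; congr (_ *: _).
by field.
Qed.

Let lact_relator x : lact (quadratic_relator e c) x = 0.
Proof.
have lin : linear (fun y => lact y x) by move=> a y z; exact: lact_linl.
rewrite /quadratic_relator.
have D y z : lact (y + z) x = lact y x + lact z x.
  by have := lin 1 y z; rewrite !scale1r.
rewrite (big_morph (fun y => lact y x) D (linear_at0 lin)).
under eq_bigr => i _.
  rewrite (linear_scale_sum _ _ lin).
  under eq_bigr => j _ do rewrite lact_br !free_lie_act_gen // !vact_basis.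
  over.
rewrite half_commutators.
rewrite (@linear_malgE _ _ (fun x => \sum_i \sum_j
  c i j *: lin_ext (act i) (lin_ext (act j) x))).
  apply: lin_ext_eq0 => w; rewrite -[RHS](act_relation actP w).
  by apply: eq_bigr => i _; apply: eq_bigr => j _; rewrite lin_extU.
move=> a y z; rewrite scaler_sumr -big_split; apply: eq_bigr => i _.
rewrite scaler_sumr -big_split; apply: eq_bigr => j _ /=.
by rewrite linearP /= linearP /= scalerDr !scalerA mulrC.
Qed.

Local Notation qact := (lie_quot_act lact : L -> M -> M).
Local Notation uact := (envelope_act qact).

Let lact_S y u : S y -> lact y u = 0.
Proof.
move=> /S_relator [lam ->]; rewrite -[lam *: _]addr0 lact_linl lact_relator.
rewrite scaler0 add0r.
by have := lact_linl (-1) 0 0 u; rewrite scaler0 addr0 scaleN1r addNr.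
Qed.

Let qact_linl := lie_quot_act_linl lact_linl lact_linr lact_br lact_S.
Let qact_linr := lie_quot_act_linear (S := S) lact_linr.
Let qact_br := lie_quot_act_br lact_linl lact_linr lact_br lact_S.

Let x (i : 'I_m) : U := env_gen (\pi_(lie_quot S) (lie_gen (e i))).

Let uact_x i u : uact (x i) u = lin_ext (act i) u.
Proof.
rewrite (envelope_act_gen qact_linl qact_linr qact_br).
rewrite (lie_quot_act_pi lact_linl lact_linr lact_br lact_S).
by rewrite (free_lie_act_gen vact_linl vact_linr) vact_basis.
Qed.

(** Tails of normal words are normal, so each letter is simply prepended. Acting on the empty word
    thus separates the normal monomials. *)
Let uact_word w : nrm w -> uact (word_prod x w) << [::] >> = << w >>.
Proof.
elim: w => [|i w ih] h.
  by rewrite /word_prod big_nil (envelope_act1 qact_linl qact_linr qact_br).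
rewrite /word_prod big_cons (envelope_actM qact_linl qact_linr qact_br).
rewrite -/(word_prod x w) ih ?uact_x ?lin_extU ?(act_nrm actP) //.
exact: (nrm_tail actP h).
Qed.

Let gen (y : free_lie V) : U := env_gen (\pi_(lie_quot S) y).

Let gen_linear : linear gen.
Proof.
move=> a y z; rewrite /gen -env_gen_linear; congr env_gen.
exact: quotmod_pi_linear.
Qed.

Let gen_br y z : gen (lie_br y z) = gen y * gen z - gen z * gen y.
Proof. by rewrite /gen lie_quot_piR env_gen_br. Qed.

Let x_relation : \sum_i \sum_j c i j *: (x i * x j) = 0.
Proof.
have h0 : gen (quadratic_relator e c) = 0.
  rewrite -(linear_at0 gen_linear) /gen; congr env_gen; apply/lie_quotP.
  by rewrite subr0.
rewrite -[RHS]h0.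
have D y z : gen (y + z) = gen y + gen z.
  by have := gen_linear 1 y z; rewrite !scale1r.
rewrite -half_commutators /quadratic_relator.
rewrite (big_morph gen D (linear_at0 gen_linear)); apply: eq_bigr => i _.
rewrite (linear_scale_sum _ _ gen_linear); apply: eq_bigr => j _.
by rewrite gen_br.
Qed.

Let phi : M -> U := lin_ext (word_prod x).

Let phi_linear : linear phi.
Proof. exact: linearP. Qed.

(** [phi] intertwines the action on words with left multiplication, because the x_i satisfy the
    relation in U. This turns reduction of words into spanning in U. *)
Let phi_act i v : phi (lin_ext (act i) v) = x i * phi v.
Proof.
rewrite /phi linear_lin_ext [in RHS]/lin_ext mulr_sumr; apply: eq_bigr => w _.
by rewrite /= (act_prod actP x_relation) scalerAr.
Qed.

Let gen_gen_phi v u : gen (lie_gen v) * phi u = phi (vact v u).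
Proof.
have lin : linear (fun v => gen (lie_gen v)).
  by move=> a y z; rewrite lie_gen_linear gen_linear.
rewrite {1}[v]span (linear_scale_sum _ _ lin) mulr_suml.
rewrite /vact (linear_scale_sum _ _ phi_linear).
by apply: eq_bigr => i _; rewrite -scalerAl phi_act.
Qed.

Let act_normal i k v : normal_span nrm k v ->
  normal_span nrm k.+1 (lin_ext (act i) v).
Proof.
elim=> [|a u y [w [hw <- ->]] _ hy]; first by rewrite linear0; exact: lspan_0.
rewrite linearP /=; apply: lspanD hy; apply: lspanZ; rewrite lin_extU.
exact: (act_span actP).
Qed.

(** Induction on the construction of y: generators act through the letters, each raising the length
    by one, and brackets act as commutators. *)
Let gen_span k y l v : free_lie_deg k y -> normal_span nrm l v ->
  exists2 v', normal_span nrm (k + l) v' & gen y * phi v = phi v'.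
Proof.
move=> h; elim: h l v => {k y} [k|k a y z _ hy _ hz|w|i j y z _ hy _ hz] l v hv.
- exists 0; first exact: lspan_0.
  by rewrite (linear_at0 gen_linear) mul0r (linear_at0 phi_linear).
- have [v1 s1 e1] := hy _ _ hv; have [v2 s2 e2] := hz _ _ hv.
  exists (a *: v1 + v2); first by apply: lspanD s2; exact: lspanZ.
  by rewrite gen_linear mulrDl -scalerAl e1 e2 phi_linear.
- exists (vact w v); last exact: gen_gen_phi.
  apply: big_ind => [||i _]; [exact: lspan_0|exact: lspanD|].
  by apply: lspanZ; exact: act_normal.
- have [v1 s1 e1] := hz _ _ hv; have [v2 s2 e2] := hy _ _ s1.
  have [v3 s3 e3] := hy _ _ hv; have [v4 s4 e4] := hz _ _ s3.
  exists (v2 - v4).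
    apply: lspanD; first by rewrite -addnA.
    by apply: lspanN; rewrite [(i + j)%N]addnC -addnA.
  by rewrite gen_br mulrBl -!mulrA e1 e2 e3 e4 /phi linearB.
Qed.

(** The grading [holonomy_deg] for an arbitrary set S of relators; the two agree by unfolding. *)
Definition lie_quot_deg (k : nat) : set L :=
  fun y => exists z : free_lie V, free_lie_deg k z /\ y = \pi_(lie_quot S) z.

Let deg_span k u l v : envelope_deg lie_quot_deg k u -> normal_span nrm l v ->
  exists2 v', normal_span nrm (k + l) v' & u * phi v = phi v'.
Proof.
move=> h; elim: h l v => {k u}
  [k|k a y z _ hy _ hz||k y [z [hz ->]]|i j y z _ hy _ hz] l v hv.
- by exists 0; [exact: lspan_0|rewrite mul0r (linear_at0 phi_linear)].
- have [v1 s1 e1] := hy _ _ hv; have [v2 s2 e2] := hz _ _ hv.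
  exists (a *: v1 + v2); first by apply: lspanD s2; exact: lspanZ.
  by rewrite mulrDl -scalerAl e1 e2 phi_linear.
- by exists v; rewrite ?mul1r.
- exact: gen_span.
- have [v1 s1 e1] := hz _ _ hv; have [v2 s2 e2] := hy _ _ s1.
  by exists v2; rewrite -?addnA // -mulrA e1 e2.
Qed.

Let word_deg w : envelope_deg lie_quot_deg (size w) (word_prod x w).
Proof.
elim: w => [|i w ih]; rewrite /word_prod; first by rewrite big_nil; exact: evd_1.
rewrite big_cons -[size _]/(1 + size w)%N; apply: evd_mul ih; apply: evd_gen.
by exists (lie_gen (e i)); split=> //; exact: fld_gen.
Qed.

(** For independence, act on the empty word and read off coefficients by [uact_word]. For spanning,
    apply [deg_span] to the empty word, whose image under [phi] is 1. *)
Lemma envelope_normal_basis k :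
  has_dim (envelope_deg lie_quot_deg k) (size (filter nrm (words m k))).
Proof.
set ws := filter nrm _.
have wsP i : (i < size ws)%N -> nrm (nth [::] ws i) /\ size (nth [::] ws i) = k.
  by move=> /(mem_nth [::]); rewrite mem_filter mem_words => /andP [-> /eqP].
have uws : uniq ws by rewrite filter_uniq // uniq_words.
exists (fun i => word_prod x (nth [::] ws i)); split=> [d h i|u].
  pose f u := uact u << [::] >>.
  have fl : linear f.
    by move=> a u v; exact: (envelope_act_linl qact_linl qact_linr qact_br).
  have := linear_scale_sum d (fun i : 'I_(size ws) => word_prod x (nth [::] ws i)) fl.
  rewrite h (linear_at0 fl) => /(congr1 (mcoeff (nth [::] ws i))).
  rewrite mcoeff0 raddf_sum (bigD1 i) //= big1 => [|j /negPf ji].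
    by rewrite addr0 mcoeffZ /f uact_word ?(wsP i _).1 // mcoeffUU mulr1 => <-.
  rewrite mcoeffZ /f uact_word ?(wsP j _).1 // mcoeffU nth_uniq //.
  by rewrite val_eqE ji mulr0.
split=> [hu|[d ->]]; last first.
  elim/big_rec: _ => [|i y _ hy]; first exact: evd_0.
  have [_ sz] := wsP i (ltn_ord i).
  by apply: evd_lin hy; rewrite -[in X in envelope_deg _ X]sz; exact: word_deg.
have one : normal_span nrm 0 << [::] >>.
  by apply: lspan_in; exists [::]; split=> //; exact: (nrm_nil actP).
have [v' sv' e'] := deg_span hu one.
have {u hu e'} -> : u = phi v'.
  by rewrite -e' /phi lin_extU /word_prod big_nil mulr1.
rewrite addn0 in sv'; elim: sv' => [|a y z [w [hw sw ->]] _ [d hd]].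
  exists (fun=> 0); rewrite (linear_at0 phi_linear) big1 // => i _.
  by rewrite scale0r.
have wws : w \in ws by rewrite mem_filter hw mem_words sw eqxx.
have lt : (index w ws < size ws)%N by rewrite index_mem.
exists (fun i => a * (i == Ordinal lt)%:R + d i).
rewrite phi_linear hd; under [in RHS]eq_bigr do rewrite scalerDl.
rewrite big_split; apply: congr2 => //; rewrite (bigD1 (Ordinal lt)) //= big1.
  by rewrite addr0 eqxx mulr1 nth_index // /phi lin_extU.
by move=> i /negPf ->; rewrite mulr0 scale0r.
Qed.

End EnvelopeBasis.

(** * Counting words that avoid ab, and the resulting power series *)

Section Counting.
Variable m : nat.

Lemma count_allpairs_cons (P : pred (seq 'I_m)) s t :
  count P [seq i :: w | i <- s, w <- t] =
  (\sum_(i <- s) count (fun w => P (i :: w)) t)%N.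
Proof.
elim: s => [|i s ih] /=; first by rewrite big_nil.
by rewrite count_cat ih big_cons count_map.
Qed.

Lemma count_wordsS (P : pred (seq 'I_m)) k :
  count P (words m k.+1) = (\sum_i count (fun w => P (i :: w)) (words m k))%N.
Proof. by rewrite /= count_allpairs_cons big_enum. Qed.

Lemma size_words k : size (words m k) = (m ^ k)%N.
Proof.
elim: k => // k ih; rewrite -count_predT count_wordsS.
under eq_bigr do rewrite count_predT ih.
by rewrite sum_nat_const card_ord expnS.
Qed.

Variables (a b : 'I_m).
Hypothesis ab : a != b.
Local Notation N k := (count (avoids_ab a b) (words m k)).

Let avoids_cons i w : i != a -> avoids_ab a b (i :: w) = avoids_ab a b w.
Proof. by move=> ia; case: w => //= j w; rewrite (negPf ia). Qed.

Lemma avoids_ab1 : N 1 = m.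
Proof. by rewrite count_wordsS sum1_card card_ord. Qed.

(** Prepending any letter to an avoiding word of length k + 1 keeps it avoiding, except for a before
    a word b w. Such words correspond to the avoiding words w of length k. *)
Lemma avoids_abSS k : (N k.+2 + N k = m * N k.+1)%N.
Proof.
have -> : (m * N k.+1 = \sum_(i < m) N k.+1)%N by rewrite sum_nat_const card_ord.
rewrite count_wordsS (bigD1 a) //= [RHS](bigD1 a) //= -addnA [X in (_ + X)%N]addnC addnA.
congr (_ + _)%N; last first.
  by apply: eq_bigr => i ia; apply: eq_count => w; exact: avoids_cons.
have avb (w : seq 'I_m) : avoids_ab a b (b :: w) = avoids_ab a b w.
  by apply: avoids_cons; rewrite eq_sym.
have <- : count (fun w => avoids_ab a b w && (ohead w == Some b)) (words m k.+1) = N k.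
  rewrite count_wordsS (bigD1 b) //= [X in (_ + X)%N]big1 ?addn0 => [|i ib].
    by apply: eq_count => w; rewrite eqxx andbT; exact: avb.
  rewrite -(count_pred0 (words m k)); apply: eq_count => w.
  by rewrite -[RHS](andbF (avoids_ab a b (i :: w))); congr (_ && _); apply/negbTE.
rewrite -!sum1_count [RHS](bigID (fun w => ohead w == Some b)) /= addnC.
congr (_ + _)%N; apply: eq_bigl => -[|i w] //=.
by rewrite eqxx /= andbC.
Qed.

End Counting.

Section PowerSeries.
Variables (p : {poly rat}) (u v : rat).
Hypotheses (p0 : p`_0 = 1) (p1 : p`_1 = - u) (p2 : p`_2 = v).
Hypothesis p3 : forall k, p`_k.+3 = 0.

(** As p = 1 - u t + v t^2, only three terms of the convolution of p with its inverse survive, and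
    they give the same recurrence. *)
Lemma fps_inv_rec2 (s : nat -> rat) :
    s 0%N = 1 -> s 1%N = u -> (forall k, s k.+2 = u * s k.+1 - v * s k) ->
  forall k, s k = fps_inv p k.
Proof.
move=> s0 s1 ss; have E := fps_mulVp p0.
have f0 : fps_inv p 0 = 1 by have := E 0%N; rewrite big_ord1 p0 mulr1.
have f1 : fps_inv p 1 = u.
  by have := E 1%N; rewrite big_ord_recr big_ord1 /= p0 p1 f0; lra.
have ff k : fps_inv p k.+2 = u * fps_inv p k.+1 - v * fps_inv p k.
  have := E k.+2; rewrite !big_ord_recr /= subnn subSnn -addn2 addKn p0 p1 p2.
  rewrite big1; first by lra.
  move=> i _; have -> : (k + 2 - i)%N = (k - i.+1)%N.+3.
    by rewrite subnSK // addn2 !subSn // ltnW // leqW // ltnW.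
  by rewrite p3 mulr0.
move=> k; have [] : s k = fps_inv p k /\ s k.+1 = fps_inv p k.+1; last by [].
elim: k => [|k [e1 e2]]; first by rewrite s0 s1 f0 f1.
by split=> //; rewrite ss ff e1 e2.
Qed.

End PowerSeries.

(** * Hilbert series from cup products of a dual basis *)

Section HolonomyHilbert.
Variables (G : groupType) (m : nat).
Variables (e : 'I_m -> homology1 G) (chi : 'I_m -> cohomology1 G).
Hypothesis dual : forall i j, eval1 (chi i) (e j) = (i == j)%:R.
Hypothesis span : forall v, v = \sum_i eval1 (chi i) v *: e i.

Local Notation B z i j := (eval2 (cup (chi i) (chi j)) z).
Local Notation U_deg := (envelope_deg (@holonomy_deg G)).

Let co_linear i a u v :
  eval1 (chi i) (a *: u + v) = a * eval1 (chi i) u + eval1 (chi i) v.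
Proof. exact: eval1_linr. Qed.

Let relator0 (c : 'I_m -> 'I_m -> rat) :
  (forall i j, c i j = 0) -> quadratic_relator e c = 0.
Proof.
move=> c0; rewrite /quadratic_relator big1 // => i _; rewrite big1 // => j _.
by rewrite c0 mul0r scale0r.
Qed.

(** All relators vanish, so the basis result applies with c = 0 and every word normal. *)
Lemma holonomy_hilbert_free k : (forall z i j, B z i j = 0) ->
  has_dim (U_deg k) (m ^ k).
Proof.
move=> B0; rewrite -size_words -(filter_predT (words m k)).
apply: (@envelope_normal_basis _ _ e (fun i => eval1 (chi i)) co_linear span dual
  (fun _ _ => 0)).
- by move=> i j; rewrite oppr0.
- move=> x [w [[z hz] ->]]; exists 0; rewrite scale0r.
  rewrite (dual_cup_lie span hz); exact: relator0.
- by rewrite relator0 //; exact: li_0.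
- exact: free_word_action.
Qed.

(** All relators are multiples of the one attached to z0, and that one does occur by
    [dual_cup_exists]. Its coefficient at (a, b) is the leading one. *)
Lemma holonomy_hilbert_quadratic z0 a b k :
    (forall z, exists lam, forall i j, B z i j = lam * B z0 i j) ->
    B z0 a b != 0 ->
  has_dim (U_deg k) (count (avoids_ab a b) (words m k)).
Proof.
move=> Bz Bab; rewrite -size_filter.
apply: (@envelope_normal_basis _ _ e (fun i => eval1 (chi i)) co_linear span dual
  (fun i j => B z0 i j)).
- by move=> i j; rewrite eval2_cupC.
- move=> x [w [[z hz] ->]]; have [lam hl] := Bz z; exists lam.
  rewrite (dual_cup_lie span hz) /quadratic_relator scaler_sumr.
  apply: eq_bigr => i _; rewrite scaler_sumr; apply: eq_bigr => j _.
  by rewrite hl scalerA mulrA.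
- have [w hw] := dual_cup_exists span z0.
  by apply: li_in; exists w; split; [exists z0|rewrite (dual_cup_lie span hw)].
- by apply: quadratic_word_action => //; rewrite cup_alt eval2_0.
Qed.

Lemma is_hilb_free : (forall z i j, B z i j = 0) ->
  is_hilb U_deg (fps_inv (1 - m%:R *: 'X)).
Proof.
move=> B0 k; exists (m ^ k)%N; split; first exact: holonomy_hilbert_free.
apply/esym; apply: (@fps_inv_rec2 _ m%:R 0 _ _ _ _
  (fun k => (m ^ k)%:R)); rewrite ?coefE /=; try ring.
- by move=> j; rewrite !coefE /=; ring.
- by move=> j; rewrite expnS natrM; ring.
Qed.

Lemma is_hilb_quadratic z0 a b :
    (forall z, exists lam, forall i j, B z i j = lam * B z0 i j) ->
    B z0 a b != 0 ->
  is_hilb U_deg (fps_inv (1 - m%:R *: 'X + 'X^2)).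
Proof.
move=> Bz Bab k; exists (count (avoids_ab a b) (words m k)).
split; first exact: holonomy_hilbert_quadratic Bz Bab.
apply/esym; apply: (@fps_inv_rec2 _ m%:R 1 _ _ _ _
  (fun k => (count (avoids_ab a b) (words m k))%:R));
  rewrite ?coefE /=; try ring.
- by move=> j; rewrite !coefE /=; ring.
- by rewrite avoids_ab1.
- move=> j; have ab : a != b.
    by apply: contraNneq Bab => ->; rewrite cup_alt eval2_0.
  by rewrite -natrM -(avoids_abSS ab) natrD; ring.
Qed.

End HolonomyHilbert.

(** * First homology and cohomology of a one-relator group *)

Section OneRelatorHomology.
Variables (n : nat) (r : free_group n).
Local Notation F := (free_group n).
Local Notation G := (one_relator_group r).
Local Notation pi := (\pi_(quotient_group (fun x : F => x = r)) : F -> G).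

Definition free_class (x : F) : homology1 G := \pi_(homology1 G) << pi x >>.

Lemma homology1_M (H : groupType) (g h : H) :
  \pi_(homology1 H) << (g * h)%g >> =
  \pi_(homology1 H) << g >> + \pi_(homology1 H) << h >> :> homology1 H.
Proof.
rewrite -[_ + _]linearD; apply/quotmodP.
rewrite -opprB; apply/lspanN/lspan_in; exists << (g, h) >>.
by rewrite bar_d2U [RHS]addrAC [<< h >> + _]addrC.
Qed.

Lemma free_classM x y : free_class (x * y)%g = free_class x + free_class y.
Proof. by rewrite /free_class quotient_group_piM; exact: homology1_M. Qed.

Lemma free_class_hom (W : lmodType rat) (psi : F -> W) x :
    (forall x y, psi (x * y)%g = psi x + psi y) ->
  psi x = \sum_i fsum (delta i) x *: psi (free_gen i).
Proof.
move=> psiM; apply/eqP; rewrite -subr_eq0; apply/eqP; move: x.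
apply: free_group_hom0 => [x y|i].
  rewrite psiM addrACA -opprD -big_split; congr (_ - _).
  by apply: eq_bigr => i _; rewrite fsumM scalerDl.
rewrite (bigD1 i) //= fsum_gen /delta eqxx scale1r big1 ?addr0 ?subrr // => j ji.
by rewrite fsum_gen (negPf ji) scale0r.
Qed.

Section Descend.
Variable v : 'I_n -> rat.
Hypothesis v0 : fsum v r = 0.

Lemma fsum_relator_eq x y : pi x = pi y -> fsum v x = fsum v y.
Proof.
move=> /quotient_groupP /relator_exponent [a [sa _]].
by have := sa v; rewrite v0 mulr0 fsumM fsumV; lra.
Qed.

Fact descend_is_cocycle : is_cocycle1 (fun g : G => fsum v (repr g) : rat^o).
Proof.
apply/is_cocycle1P => g h; rewrite -fsumM; apply: fsum_relator_eq.
by rewrite quotient_group_piM !reprK.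
Qed.

Definition descend : cohomology1 G := 
  exist (fun f => is_true (is_cocycle1 f)) _ descend_is_cocycle.

Lemma descend_pi x : val descend (pi x) = fsum v x.
Proof. by apply: fsum_relator_eq; rewrite reprK. Qed.

Lemma eval1_descend x : eval1 descend (free_class x) = fsum v x.
Proof. by rewrite eval1_pi lin_extU descend_pi. Qed.

Lemma gen_values_descend : gen_values descend = v.
Proof. by apply/funext => i; rewrite /gen_values descend_pi fsum_gen. Qed.

End Descend.

(** Both sides are linear in v, H_1 is spanned by classes of group elements, and these are
    combinations of the classes of the x_k. *)
Lemma homology1_span m (e : 'I_m -> homology1 G) (chi : 'I_m -> cohomology1 G) :
    (forall k, free_class (free_gen k) =
       \sum_i eval1 (chi i) (free_class (free_gen k)) *: e i) ->
  forall v, v = \sum_i eval1 (chi i) v *: e i.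
Proof.
move=> gens; pose f (v : homology1 G) := \sum_i eval1 (chi i) v *: e i.
have fl : linear f.
  move=> a u v; rewrite /f scaler_sumr -big_split; apply: eq_bigr => i _.
  by rewrite eval1_linr scalerDl scalerA.
have fD u v : f (u + v) = f u + f v by have := fl 1 u v; rewrite !scale1r.
have cls x : free_class x = f (free_class x).
  rewrite {1}(free_class_hom x free_classM).
  rewrite (free_class_hom (psi := fun x => f (free_class x)) x) => [|y z].
    by apply: eq_bigr => k _; rewrite {1}gens.
  by rewrite free_classM fD.
elim/quotW => c; rewrite -/(f _).
have pil : linear (\pi_(homology1 G) : _ -> homology1 G) by exact: quotmod_pi_linear.
rewrite {1}(linear_malgE c pil).
rewrite (linear_malgE (f := fun c => f (\pi_(homology1 G) c)) c) => [|a y z].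
  apply: eq_bigr => g _; congr (_ *: _).
  by have := cls (repr g); rewrite /free_class reprK.
by rewrite pil fl.
Qed.

End OneRelatorHomology.

Lemma scale_opp (V : lmodType rat) (a b c : rat) (w : V) :
  a * b = - c -> a *: (b *: w) = - (c *: w).
Proof. by move=> h; rewrite scalerA h scaleNr. Qed.

(** * The three ranges of the weight *)

Section OneRelatorCases.
Variables (n : nat) (r : free_group n).
Local Notation F := (free_group n).
Local Notation G := (one_relator_group r).
Local Notation U_deg := (envelope_deg (@holonomy_deg G)).

Section CommutatorRelator.
Hypothesis r2 : lower_central 2 r.

Let e i : homology1 G := free_class r (free_gen i).
Let chi i : cohomology1 G := descend (fsum_lower_central2 (delta i) r2).

Let dual i j : eval1 (chi i) (e j) = (i == j)%:R.
Proof. by rewrite eval1_descend fsum_gen. Qed.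

Let span v : v = \sum_i eval1 (chi i) v *: e i.
Proof.
apply: homology1_span => k; rewrite (bigD1 k) //= dual eqxx scale1r.
by rewrite big1 ?addr0 // => i /negPf ik; rewrite dual ik scale0r.
Qed.

Let cupE (z : homology2 G) : exists lam, forall i j,
  eval2 (cup (chi i) (chi j)) z = lam * magnus (delta i) (delta j) r.
Proof.
elim/quotW: z => z; have [lam [_ h]] := cycle2_magnus z; exists lam => i j.
by rewrite h !gen_values_descend.
Qed.

Lemma is_hilb_depth3 : lower_central 3 r ->
  is_hilb U_deg (fps_inv (1 - n%:R *: 'X)).
Proof.
move=> r3; apply: (is_hilb_free dual span) => z i j.
by have [lam ->] := cupE z; rewrite magnus_lower_central3 // mulr0.
Qed.

(** The cycle of [relator_cycle] realises the Magnus coefficients of r themselves; one of them is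
    nonzero, since otherwise r would lie in Gamma_3. *)
Lemma is_hilb_depth2 : ~ lower_central 3 r ->
  is_hilb U_deg (fps_inv (1 - n%:R *: 'X + 'X^2)).
Proof.
move=> nr3; have [z hz] := relator_cycle r2.
have hzE i j : eval2 (cup (chi i) (chi j)) (\pi_(homology2 G) z) =
    magnus (delta i) (delta j) r by rewrite hz !gen_values_descend.
have [a [b hab]] : exists a b, magnus (delta a) (delta b) r != 0.
  apply: contrapT => h; apply: nr3; apply: magnus_eq0_lower_central3 => // i j.
  by apply/eqP; apply: contrapT => /negP hij; apply: h; exists i, j.
apply: (is_hilb_quadratic dual span (z0 := \pi_(homology2 G) z) (a := a) (b := b)).
  by move=> z'; have [lam hl] := cupE z'; exists lam => i j; rewrite hl hzE.
by rewrite hzE.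
Qed.

End CommutatorRelator.

Section NonCommutatorRelator.
Variable p : 'I_n.
Hypothesis rp : fsum (delta p) r != 0.

(** The relation given by r in H_1 is solved for x_p: its class is minus the sum of the q_j times
    the classes of the other generators. *)
Let q (j : 'I_n.-1) : rat := fsum (delta (lift p j)) r / fsum (delta p) r.
(** The coordinate of a remaining generator, corrected by a multiple of that of x_p so as to vanish
    on r and descend to G. *)
Let v (j : 'I_n.-1) (k : 'I_n) : rat := delta (lift p j) k - q j * delta p k.

Let fsum_v j x : fsum (v j) x = fsum (delta (lift p j)) x - q j * fsum (delta p) x.
Proof.
apply/esym.
apply: (fsum_hom (psi := fun x => fsum (delta (lift p j)) x - q j * fsum (delta p) x)).
  by move=> y z; rewrite !fsumM; ring.
by move=> i; rewrite !fsum_gen.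
Qed.

Let v0 j : fsum (v j) r = 0.
Proof. by rewrite fsum_v /q divfK // subrr. Qed.

Let e j : homology1 G := free_class r (free_gen (lift p j)).
Let chi j : cohomology1 G := descend (v0 j).

Let dual i j : eval1 (chi i) (e j) = (i == j)%:R.
Proof.
rewrite eval1_descend fsum_gen /v /delta (inj_eq lift_inj).
by rewrite (negPf (neq_lift p j)) mulr0 subr0.
Qed.

Let free_class_relator : free_class r r = 0.
Proof.
have -> : free_class r r = free_class r 1%g by rewrite /free_class pi_relator.
by apply: (addrI (free_class r 1%g)); rewrite -free_classM mulg1 addr0.
Qed.

Let span x : x = \sum_i eval1 (chi i) x *: e i.
Proof.
apply: homology1_span => k; case: (unliftP p k) => [i ->|->].
  rewrite -/(e i) (bigD1 i) //= dual eqxx scale1r.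
  by rewrite big1 ?addr0 // => j /negPf ji; rewrite dual ji scale0r.
(* The remaining generator is x_p; the vanishing of the class of r expresses it by the others. *)
have := free_class_hom (psi := free_class r) r (@free_classM _ r).
rewrite free_class_relator (bigD1_ord p) //= => /esym/eqP.
rewrite addr_eq0 => /eqP h.
apply: (scalerI rp); rewrite h scaler_sumr -sumrN; apply: eq_bigr => i _.
apply/esym/scale_opp; rewrite eval1_descend fsum_gen /v /delta eqxx [lift p i == p]eq_sym.
by rewrite (negPf (neq_lift p i)) mulr1 sub0r mulrN mulrC divfK.
Qed.

(** By [cycle2_magnus], lam times the nonzero exponent sum of x_p in r is 0. So lam = 0, all cup
    products vanish on cycles, and n - 1 free generators remain. *)
Lemma is_hilb_depth1 : is_hilb U_deg (fps_inv (1 - (n%:R - 1) *: 'X)).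
Proof.
(* The index p forces n > 0, so the truncated predecessor is the true one. *)
have -> : n%:R - 1 = n.-1%:R :> rat.
  by rewrite -[in LHS](prednK (leq_ltn_trans (leq0n p) (ltn_ord p))) -natr1 addrK.
apply: (is_hilb_free dual span) => z i j.
elim/quotW: z => z; have [lam [h0 ->]] := cycle2_magnus z.
have /eqP := h0 (delta p); rewrite mulf_eq0 (negPf rp) orbF => /eqP ->.
by rewrite mul0r.
Qed.

End NonCommutatorRelator.

End OneRelatorCases.

Theorem corollary8p2 (n : nat) (r : free_group n) :
  let G := one_relator_group r in
  let h : lieAlgType := holonomy G in
  let U_deg : nat -> envelope h -> Prop := envelope_deg (@holonomy_deg G) in
  [/\ weight r = Some 1%N ->
        is_hilb U_deg (fps_inv (1 - (n%:R - 1) *: 'X)),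
      weight r = Some 2%N ->
        is_hilb U_deg (fps_inv (1 - n%:R *: 'X + 'X^2))
    & weight_ge 3 r ->
        is_hilb U_deg (fps_inv (1 - n%:R *: 'X))].
Proof.
split=> [/weight_SomeP [_ _ max]|/weight_SomeP [_ r2 max]|/weight_ge_lower_central r3].
(* Maximality of depth 1 excludes Gamma_2, so some exponent sum of r is nonzero. *)
- have nr2 : ~ lower_central 2 r by move=> /(max 2%N isT).
  have [p rp] : exists p, fsum (delta p) r != 0.
    apply: contrapT => h; apply/nr2/fsum_eq0_lower_central2 => i.
    by apply/eqP; apply: contrapT => /negP hi; apply: h; exists i.
  exact: is_hilb_depth1 rp.
- by apply: is_hilb_depth2 => // /(max 3%N isT).
- exact: (is_hilb_depth3 (lower_centralS r3) r3).
Qed.
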